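(* Let $\mathbb K$ be a field of characteristic $0$. Let $g\in\mathbb K[X][Y]$ be an irreducible polynomial of total degree $d$ with $\partial g/\partial Y\neq0$, and let $\phi\in\overline{\mathbb K}\{\{X\}\}$ be a root of $g$ (as a polynomial in $Y$) of valuation $v$. Let $f=\sum_{j=1}^\ell c_jX^{\alpha_j}Y^{\beta_j}$ with all $c_j\neq0$ and pairwise distinct exponent pairs $(\alpha_j,\beta_j)$, and suppose that the family $(X^{\alpha_j}\phi^{\beta_j})_{1\le j\le\ell}$ is linearly independent over $\overline{\mathbb K}$. Then \[\mathrm{val}\bigl(f(X,\phi(X))\bigr)\le\min_{1\le j\le\ell}(\alpha_j+v\beta_j)+\bigl(2d(4d+1)-v\bigr)\binom{\ell}{2}.\]
   Context: $\overline{\mathbb K}\{\{X\}\}$ denotes the field of Puiseux series over the algebraic closure $\overline{\mathbb K}$: formal sums $\phi=\sum_{t\ge t_0}f_tX^{t/e}$ with $f_t\in\overline{\mathbb K}$, $f_{t_0}\neq0$, $t_0\in\mathbb Z$, $e\in\mathbb N_{>0}$; its valuation is $\mathrm{val}(\phi)=t_0/e$ (and $\mathrm{val}(0)=+\infty$). *)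

(* Defs.v *)
From HB Require Import structures.
From mathcomp Require Import all_boot all_order all_algebra.
Set Implicit Arguments. Unset Strict Implicit. Unset Printing Implicit Defensive.
Import Order.TTheory GRing.Theory Num.Theory.
Local Open Scope ring_scope.

(* A Puiseux series  phi = sum_{k>=0} pco k * X^((k - psh) / (pden+1)).
   Every Puiseux series sum_{t>=t0} f_t X^(t/e) has such a representation
   (e = pden+1, psh >= -t0); the representation is not unique, so all the
   notions below are semantic (via the coefficient function [pcoef]). *)
Record puis (L : Type) := Puis { pden : nat; psh : nat; pco : nat -> L }.

Section Puiseux.
Variable L : fieldType.

(* coefficient of X^(z / ((pden s).+1 * r)) in s, for r > 0 *)
Definition zco (s : puis L) (r : nat) (z : int) : L :=
  match (z + (psh s * r)%:Z)%R with
  | Posz k => if (r %| k)%N then pco s (k %/ r)%N else 0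
  | Negz _ => 0
  end.

Definition pcoef (s : puis L) (q : rat) : L :=
  let z := q * ((pden s).+1)%:R in
  if denq z == 1 then zco s 1 (numq z) else 0.

Definition pzero_s : puis L := Puis 0 0 (fun _ => 0).
Definition pX (a : nat) : puis L := Puis 0 0 (fun k => if k == a then 1 else 0).
Definition pone : puis L := pX 0.
Definition pscale (c : L) (s : puis L) : puis L :=
  Puis (pden s) (psh s) (fun k => c * pco s k).

Definition padd (s t : puis L) : puis L :=
  let es := (pden s).+1 in let et := (pden t).+1 in
  let M := (psh s * et + psh t * es)%N in
  Puis (es * et).-1 M
    (fun k => zco s et (k%:Z - M%:Z) + zco t es (k%:Z - M%:Z)).

Definition pmul (s t : puis L) : puis L :=
  let es := (pden s).+1 in let et := (pden t).+1 in
  let Ms := (psh s * et)%N in let Mt := (psh t * es)%N in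
  Puis (es * et).-1 (Ms + Mt)
    (fun k => \sum_(i < k.+1)
        zco s et (i%:Z - Ms%:Z) * zco t es ((k - i)%N%:Z - Mt%:Z)).

Definition ppow (s : puis L) (n : nat) : puis L := iter n (pmul s) pone.

Definition psum (ss : seq (puis L)) : puis L := foldr padd pzero_s ss.

Definition pzero (s : puis L) : Prop := forall q : rat, pcoef s q = 0.

Definition is_pval (s : puis L) (v : rat) : Prop :=
  pcoef s v != 0 /\ forall q : rat, q < v -> pcoef s q = 0.

End Puiseux.

Definition ppoly (K : fieldType) (L : fieldType) (emb : {rmorphism K -> L})
  (p : {poly K}) : puis L := Puis 0 0 (fun k => emb p`_k).

Definition peval (K : fieldType) (L : fieldType) (emb : {rmorphism K -> L})
  (g : {poly {poly K}}) (phi : puis L) : puis L :=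
  psum [seq pmul (ppoly emb g`_i) (ppow phi i) | i <- iota 0 (size g)].

Definition irreducible_elt (R : idomainType) (g : R) : Prop :=
  g != 0 /\ g \isn't a GRing.unit /\
  forall a b : R, g = a * b -> a \is a GRing.unit \/ b \is a GRing.unit.

Definition tdeg (K : fieldType) (g : {poly {poly K}}) : nat :=
  \big[maxn/0%N]_(i < size g) (if (g`_i != 0)%R then ((size (g`_i)%R).-1 + i)%N else 0%N).

(* Main.v *)
Require Import Defs.
From HB Require Import structures.
From mathcomp Require Import all_boot all_order all_algebra.
From mathcomp Require Import perm boolp ring zify.
Set Implicit Arguments. Unset Strict Implicit. Unset Printing Implicit Defensive.
Import Order.TTheory GRing.Theory Num.Theory.
Local Open Scope ring_scope.
Local Notation "x %:F" := (FracField.tofrac x) (format "x %:F").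

(** All the series involved live in the field of Laurent series in
    [t = X^(1/E)] for a suitable [E]; valuations below are [t]-valuations.

    On [K[X,Y]] consider the derivation
    [tangent g A = (Y g_Y) (X A_X) - (X g_X) (Y A_Y)].  It kills [g], so after
    substituting [Y := phi] it becomes [phi g_Y(phi) X d/dX].  Iterating it on a
    monomial gives [X^a Y^b Q_i] with [Q_i] of bidegree at most [(i d, i d)].
    Hence the Wronskian [W] of the [m_j = X^(alpha_j) phi^(beta_j)] for this
    derivation is [(\prod_j m_j) P(X, phi)] with [P] of bidegree at most
    [(C d, C d)], [C = binomial l 2].  By linear independence [W] is nonzero, and
    the resultant of [P] and [g] (nonzero by irreducibility and Gauss's lemma)
    bounds the valuation of [P(X, phi)] from above.  Replacing the column [j0] of
    the Wronskian by the derivatives of [f(X, phi)] multiplies [W] by [c_j0], and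
    bounds its valuation from below in terms of that of [f(X, phi)].  Comparing
    the two bounds gives the theorem; when [v < 0] one also uses [- v <= d]. *)

(** * Formal power series *)

(** The wrapper keeps the Cauchy product apart from any pointwise structure on functions. *)
Record fps (L : Type) := Fps { fco : nat -> L }.
HB.instance Definition _ (L : Type) := gen_eqMixin (fps L).
HB.instance Definition _ (L : Type) := gen_choiceMixin (fps L).

Section PowerSeries.
Variable L : fieldType.
Implicit Types f g h : fps L.

Lemma fpsP f g : fco f =1 fco g -> f = g.
Proof. by case: f => f; case: g => g /= /funext ->. Qed.

Definition fps_zero := Fps (fun _ => 0 : L).
Definition fps_one := Fps (fun k => (k == 0)%:R : L).
Definition fps_opp f := Fps (fun k => - fco f k).
Definition fps_add f g := Fps (fun k => fco f k + fco g k).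
Definition fps_mul f g :=
  Fps (fun k => \sum_(i < k.+1) fco f i * fco g (k - i)).

Fact fps_addA : associative fps_add.
Proof. by move=> f g h; apply: fpsP => k /=; rewrite addrA. Qed.
Fact fps_addC : commutative fps_add.
Proof. by move=> f g; apply: fpsP => k /=; rewrite addrC. Qed.
Fact fps_add0 : left_id fps_zero fps_add.
Proof. by move=> f; apply: fpsP => k /=; rewrite add0r. Qed.
Fact fps_addN : left_inverse fps_zero fps_opp fps_add.
Proof. by move=> f; apply: fpsP => k /=; rewrite addNr. Qed.

HB.instance Definition _ :=
  GRing.isZmodule.Build (fps L) fps_addA fps_addC fps_add0 fps_addN.

Definition fps_trunc n f : {poly L} := \poly_(i < n) fco f i.

(* The ring axioms are inherited from polynomials through truncation. *)
Lemma fps_mul_trunc n f g k : (k < n)%N ->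
  fco (fps_mul f g) k = (fps_trunc n f * fps_trunc n g)`_k.
Proof.
move=> lt_kn; rewrite coefM /=; apply: eq_bigr => i _.
by rewrite !coef_poly; have := ltn_ord i => ?; rewrite !ifT //; lia.
Qed.

Lemma coef_mul_trunc n (p q p' q' : {poly L}) k :
  (forall i, (i < n)%N -> p`_i = p'`_i) -> (forall i, (i < n)%N -> q`_i = q'`_i) ->
  (k < n)%N -> (p * q)`_k = (p' * q')`_k.
Proof.
move=> ep eq lt_kn; rewrite !coefM; apply: eq_bigr => i _.
by have := ltn_ord i => ?; rewrite ep ?eq //; lia.
Qed.

Lemma coef_trunc_mul n f g i : (i < n)%N ->
  (fps_trunc n (fps_mul f g))`_i = (fps_trunc n f * fps_trunc n g)`_i.
Proof. by move=> lt_in; rewrite coef_poly lt_in (fps_mul_trunc _ _ lt_in). Qed.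

Fact fps_mulA : associative fps_mul.
Proof.
move=> f g h; apply: fpsP => k; rewrite !(@fps_mul_trunc k.+1) //.
rewrite (@coef_mul_trunc k.+1 _ _ (fps_trunc k.+1 f)
  (fps_trunc k.+1 g * fps_trunc k.+1 h)) //; last first.
  by move=> i; apply: coef_trunc_mul.
rewrite mulrA; apply: (@coef_mul_trunc k.+1) => // i ?.
by rewrite coef_trunc_mul.
Qed.
Fact fps_mulC : commutative fps_mul.
Proof.
move=> f g; apply: fpsP => k; rewrite !(@fps_mul_trunc k.+1) //.
by rewrite mulrC.
Qed.
Fact fps_mul1 : left_id fps_one fps_mul.
Proof.
move=> f; apply: fpsP => k /=; rewrite big_ord_recl big1 ?subn0 /=.
  by rewrite mul1r addr0.
by move=> i _; rewrite mul0r.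
Qed.
Fact fps_mulD : left_distributive fps_mul fps_add.
Proof.
move=> f g h; apply: fpsP => k /=; rewrite -big_split /=.
by apply: eq_bigr => i _; rewrite mulrDl.
Qed.
Fact fps_one_neq0 : fps_one != fps_zero.
Proof. by apply/eqP => [[]] /(congr1 (@^~ 0%N)) /eqP; rewrite oner_eq0. Qed.

HB.instance Definition _ := GRing.Zmodule_isComNzRing.Build (fps L)
  fps_mulA fps_mulC fps_mul1 fps_mulD fps_one_neq0.

Lemma fco0 k : fco (0 : fps L) k = 0. Proof. by []. Qed.
Lemma fco1 k : fco (1 : fps L) k = (k == 0)%:R. Proof. by []. Qed.
Lemma fcoD f g k : fco (f + g) k = fco f k + fco g k. Proof. by []. Qed.
Lemma fcoN f k : fco (- f) k = - fco f k. Proof. by []. Qed.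
Lemma fcoM f g k : fco (f * g) k = \sum_(i < k.+1) fco f i * fco g (k - i).
Proof. by []. Qed.
Lemma fco_sum I (r : seq I) (P : pred I) (F : I -> fps L) k :
  fco (\sum_(i <- r | P i) F i) k = \sum_(i <- r | P i) fco (F i) k.
Proof. by elim/big_rec2: _ => //= i y z _ ->. Qed.

Definition fpsC (c : L) := Fps (fun k => if k == 0%N then c else 0).

Lemma fco_CM c f k : fco (fpsC c * f) k = c * fco f k.
Proof.
rewrite fcoM big_ord_recl big1 ?subn0 ?addr0 //= => i _.
by rewrite mul0r.
Qed.

Fact fpsC_zmod : zmod_morphism fpsC.
Proof. by move=> a b; apply: fpsP => -[|k] //=; rewrite subrr. Qed.
Fact fpsC_monoid : monoid_morphism fpsC.
Proof.
split; first by apply: fpsP => -[|k].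
by move=> a b; apply: fpsP => k; rewrite fco_CM /=; case: eqP; rewrite ?mulr0.
Qed.
HB.instance Definition _ := GRing.isZmodMorphism.Build L (fps L) fpsC fpsC_zmod.
HB.instance Definition _ :=
  GRing.isMonoidMorphism.Build L (fps L) fpsC fpsC_monoid.

Definition fpsX : fps L := Fps (fun k => (k == 1)%:R).

Lemma fco_XM f k : fco (fpsX * f) k = if k is k'.+1 then fco f k' else 0.
Proof.
case: k => [|k]; first by rewrite fcoM big_ord1 /= mul0r.
rewrite fcoM big_ord_recl /= mul0r add0r big_ord_recl /= mul1r subSS subn0.
by rewrite big1 ?addr0 // => i _; rewrite mul0r.
Qed.

Lemma fco_XnM n f k :
  fco (fpsX ^+ n * f) k = if (k < n)%N then 0 else fco f (k - n).
Proof.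
elim: n k => [|n IHn] k; first by rewrite expr0 mul1r subn0.
by rewrite exprS -mulrA fco_XM; case: k => [|k] //; rewrite IHn ltnS subSS.
Qed.

Lemma fco_Xn n k : fco (fpsX ^+ n) k = (k == n)%:R.
Proof.
rewrite -[_ ^+ n]mulr1 fco_XnM fco1; case: ltnP => [|?]; last first.
  by congr (_%:R); lia.
by move=> ?; have -> : (k == n) = false by lia.
Qed.

Lemma fco_exp0 h n k : fco h 0 = 0 -> (k < n)%N -> fco (h ^+ n) k = 0.
Proof.
move=> h0; elim: n k => // n IHn k lt_kn.
rewrite exprS fcoM big_ord_recl h0 mul0r add0r big1 // => i _.
by rewrite IHn ?mulr0 //= /bump /=; have := ltn_ord i; lia.
Qed.

(* [f = f_0 * (1 - h)] with [h_0 = 0], and [1 - h] is inverted by its geometric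
   series. *)
Definition fps_geom h := Fps (fun k => fco (\sum_(i < k.+1) h ^+ i) k).
Definition fps_inv f : fps L :=
  if fco f 0 == 0 then f else
  fpsC (fco f 0)^-1 * fps_geom (1 - fpsC (fco f 0)^-1 * f).

(** Since [h ^+ i] starts in degree [i], the series agrees up to degree [k] with one finite
    geometric sum, and [1 - h] times that sum telescopes to [1 - h ^+ k.+1]. *)
Lemma fps_geomP h : fco h 0 = 0 -> (1 - h) * fps_geom h = 1.
Proof.
move=> h0; apply: fpsP => k.
have geomE j : (j <= k)%N ->
    fco (fps_geom h) j = fco (\sum_(i < k.+1) h ^+ i) j.
  move=> le_jk; rewrite [LHS]fco_sum fco_sum.
  rewrite -(subnKC (_ : j.+1 <= k.+1)%N) // big_split_ord /=.
  rewrite [X in _ = _ + X]big1 ?addr0 // => i _.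
  by rewrite fco_exp0 //; lia.
have -> : fco ((1 - h) * fps_geom h) k = fco ((1 - h) * \sum_(i < k.+1) h ^+ i) k.
  by rewrite !fcoM; apply: eq_bigr => i _; rewrite geomE // leq_subr.
rewrite -opprB mulNr -subrX1 opprB fcoD fcoN.
by rewrite fco_exp0 // subr0.
Qed.

Lemma fps_mulVf f : fco f 0 != 0 -> fps_inv f * f = 1.
Proof.
move=> f0; rewrite /fps_inv (negbTE f0) mulrAC.
set h := fpsC _ * f; have {1}-> : h = 1 - (1 - h) by rewrite subKr.
apply: fps_geomP.
by rewrite fcoD fcoN fco_CM mulVf // subrr.
Qed.

Definition fps_unit := [pred f : fps L | fco f 0 != 0].
Fact fps_mulVx : {in fps_unit, left_inverse 1 fps_inv *%R}.
Proof. by move=> f; apply: fps_mulVf. Qed.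
Fact fps_unitPl f g : g * f = 1 -> fps_unit f.
Proof.
move=> /(congr1 (@fco _ ^~ 0%N)); rewrite fcoM big_ord1 fco1 /= => e.
by apply: contra_eq_neq e => ->; rewrite mulr0 eq_sym oner_eq0.
Qed.
Fact fps_inv_out : {in [predC fps_unit], fps_inv =1 id}.
Proof. by move=> f; rewrite inE /= negbK /fps_inv => ->. Qed.
HB.instance Definition _ := GRing.ComNzRing_hasMulInverse.Build (fps L)
  fps_mulVx fps_unitPl fps_inv_out.

(** Splitting off the order of vanishing serves twice: for the absence of zero divisors and for the
    existence of valuations in the fraction field. *)
Lemma fps_orderP f : f != 0 ->
  exists n u, fco u 0 != 0 /\ f = u * fpsX ^+ n.
Proof.
move=> nz_f; have ex : exists k, fco f k != 0.
  apply: contrapT => all0; case/negP: nz_f; apply/eqP/fpsP => k.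
  by apply/eqP; apply: contrapT => /negP ne; apply: all0; exists k.
case: (ex_minnP ex) => n nz_n min_n; exists n, (Fps (fun k => fco f (n + k))).
split; first by rewrite /= addn0.
apply: fpsP => k; rewrite mulrC fco_XnM; case: ltnP => [lt_kn|le_nk] /=.
  by apply/eqP; apply: contraTT lt_kn => /min_n; rewrite -leqNgt.
by rewrite subnKC.
Qed.

Lemma fpsXn_neq0 n : fpsX ^+ n != 0.
Proof.
apply/eqP => /(congr1 (@fco _ ^~ n)); rewrite fco_Xn eqxx fco0.
by move/eqP; rewrite oner_eq0.
Qed.

Fact fps_idomain : GRing.integral_domain_axiom (fps L).
Proof.
move=> f g fg0; apply/norP => -[/fps_orderP[n [u [u0 fE]]]].
move=> /fps_orderP[m [w [w0 gE]]].
have /(congr1 (@fco _ ^~ (n + m)%N)) : fpsX ^+ (n + m) * (u * w) = 0.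
  by rewrite -fg0 fE gE exprD; ring.
rewrite fco_XnM ltnn subnn fcoM big_ord1 fco0 => /eqP.
by rewrite mulf_eq0 (negbTE u0) (negbTE w0).
Qed.
HB.instance Definition _ :=
  GRing.ComUnitRing_isIntegral.Build (fps L) fps_idomain.

(** The substitution [X := X^r], by which a series in one root of the variable is rewritten in a
    finer root. *)
Definition fps_subst r f :=
  Fps (fun k => if (r %| k)%N then fco f (k %/ r) else 0).

(** On truncations this is composition with ['X^r], which is multiplicative on polynomials. *)
Lemma fps_substM r f g : (0 < r)%N ->
  fps_subst r (f * g) = fps_subst r f * fps_subst r g.
Proof.
move=> r_gt0; apply: fpsP => k.
have truncE h i : (i < k.+1)%N ->
    (fps_trunc k.+1 (fps_subst r h))`_i = (fps_trunc k.+1 h \Po 'X^r)`_i.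
  move=> lt_ik; rewrite coef_comp_poly_Xn // !coef_poly lt_ik /=.
  by rewrite (leq_ltn_trans (leq_div _ _) lt_ik).
rewrite -[X in _ = fco X _]/(fps_mul _ _) (@fps_mul_trunc k.+1) //.
rewrite (coef_mul_trunc (truncE f) (truncE g)) // -comp_polyM.
rewrite coef_comp_poly_Xn //.
rewrite -[LHS]/(if (r %| k)%N then fco (fps_mul f g) (k %/ r) else 0).
case: ifP => // _; rewrite (@fps_mul_trunc k.+1) //.
exact: (leq_ltn_trans (leq_div _ _)).
Qed.

End PowerSeries.

(** * Laurent series *)

(** With [dx] read as the derivative of [x], the last hypothesis is the derivative of
    [a * d = n * b]; hence the quotient rule does not depend on the fraction chosen. *)
Lemma quotient_rule_eq (F : fieldType) (a b n d da db dn dd : F) :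
  b != 0 -> d != 0 -> a * d = n * b -> da * d + a * dd = dn * b + n * db ->
  (dn * d - n * dd) / d ^+ 2 = (da * b - a * db) / b ^+ 2.
Proof.
move=> nzb nzd adnb e.
have nE : n = a * d / b by rewrite adnb mulfK.
have dnE : dn = (da * d + a * dd - n * db) / b by rewrite e addrK mulfK.
by rewrite dnE nE; field; rewrite nzb nzd.
Qed.

Lemma quotient_ruleD (F : fieldType) (a b c d da db dc dd : F) :
  b != 0 -> d != 0 ->
  ((da * d + a * dd + (dc * b + c * db)) * (b * d)
   - (a * d + c * b) * (db * d + b * dd)) / (b * d) ^+ 2
  = (da * b - a * db) / b ^+ 2 + (dc * d - c * dd) / d ^+ 2.
Proof. by move=> nzb nzd; field; rewrite nzb nzd. Qed.

Lemma quotient_ruleM (F : fieldType) (a b c d da db dc dd : F) :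
  b != 0 -> d != 0 ->
  ((da * c + a * dc) * (b * d) - a * c * (db * d + b * dd)) / (b * d) ^+ 2
  = (da * b - a * db) / b ^+ 2 * (c / d) + a / b * ((dc * d - c * dd) / d ^+ 2).
Proof. by move=> nzb nzd; field; rewrite nzb nzd. Qed.

(** * Extension of a derivation to the fraction field *)

Section FracDerivation.
Variable R : idomainType.
Implicit Types (a b : R) (x y : {fraction R}).

Lemma frac_numden x : x = (\n_(repr x))%:F / (\d_(repr x))%:F.
Proof.
apply: (canRL (mulfK _)); first by rewrite tofrac_eq0 denom_ratioP.
rewrite -{1}[x]reprK; unlock FracField.tofrac; rewrite -[LHS]FracField.pi_mul.
apply/eqP; rewrite FracField.equivf_def /FracField.mulf.
by rewrite ?reprK !numden_Ratio ?mulf_neq0 ?oner_eq0 ?denom_ratioP // !mulr1 mulrC.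
Qed.

Variable D : R -> R.
Hypothesis DD : {morph D : a b / a + b}.
Hypothesis DM : forall a b, D (a * b) = D a * b + a * D b.

Definition frac_deriv x :=
  let a := \n_(repr x) in let b := \d_(repr x) in
  ((D a)%:F * b%:F - a%:F * (D b)%:F) / b%:F ^+ 2.

Lemma frac_deriv_repr x : exists a b, [/\ b != 0, x = a%:F / b%:F &
  frac_deriv x = ((D a)%:F * b%:F - a%:F * (D b)%:F) / b%:F ^+ 2].
Proof.
exists \n_(repr x), \d_(repr x); split; rewrite ?denom_ratioP //.
exact: frac_numden.
Qed.

Lemma frac_derivE a b : b != 0 ->
  frac_deriv (a%:F / b%:F) = ((D a)%:F * b%:F - a%:F * (D b)%:F) / b%:F ^+ 2.
Proof.
move=> nz_b; have [n [d [nz_d e ->]]] := frac_deriv_repr (a%:F / b%:F).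
have nzb : b%:F != 0 by rewrite tofrac_eq0.
have nzd : d%:F != 0 by rewrite tofrac_eq0.
have adnb : a * d = n * b.
  apply/eqP; rewrite -tofrac_eq !tofracM -[a%:F](divfK nzb) e.
  by rewrite mulrAC divfK.
apply: quotient_rule_eq => //; rewrite -?tofracM ?adnb // -!tofracD -!DM.
by rewrite adnb.
Qed.

Lemma frac_deriv_tofrac a : frac_deriv a%:F = (D a)%:F.
Proof.
have D1 : D 1 = 0.
  apply/eqP; have /eqP := DM 1 1; rewrite !mulr1 mul1r.
  by rewrite -subr_eq0 opprD addrA subrr add0r oppr_eq0.
rewrite -[a%:F]divr1 -tofrac1 frac_derivE ?oner_eq0 // D1 tofrac0 tofrac1.
by rewrite mulr1 mulr0 subr0 expr1n divr1.
Qed.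

Lemma frac_derivD : {morph frac_deriv : x y / x + y}.
Proof.
move=> x y; have [a [b [nzb xE ->]]] := frac_deriv_repr x.
have [c [d [nzd yE ->]]] := frac_deriv_repr y.
have nzbF : b%:F != 0 by rewrite tofrac_eq0.
have nzdF : d%:F != 0 by rewrite tofrac_eq0.
have -> : x + y = (a * d + c * b)%:F / (b * d)%:F.
  by rewrite xE yE tofracD !tofracM addf_div.
rewrite frac_derivE ?mulf_neq0 // DD !DM !(tofracD, tofracM).
exact: quotient_ruleD.
Qed.

Lemma frac_derivM x y :
  frac_deriv (x * y) = frac_deriv x * y + x * frac_deriv y.
Proof.
have [a [b [nzb xE ->]]] := frac_deriv_repr x.
have [c [d [nzd yE ->]]] := frac_deriv_repr y.
have nzbF : b%:F != 0 by rewrite tofrac_eq0.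
have nzdF : d%:F != 0 by rewrite tofrac_eq0.
have -> : x * y = (a * c)%:F / (b * d)%:F by rewrite xE yE !tofracM mulf_div.
rewrite xE yE frac_derivE ?mulf_neq0 // !DM !(tofracD, tofracM).
exact: quotient_ruleM.
Qed.
End FracDerivation.

(** * The [t]-adic valuation and the Euler derivation on Laurent series *)

Section Laurent.
Variable L : fieldType.
Local Notation F := {fraction (fps L)}.
Implicit Types (f g : fps L) (x y : F) (n m : int).

Definition fps_euler f := Fps (fun k => k%:R * fco f k).

Lemma fps_eulerD : {morph fps_euler : f g / f + g}.
Proof. by move=> f g; apply: fpsP => k; rewrite fcoD /= mulrDr. Qed.

Lemma fps_eulerM f g : fps_euler (f * g) = fps_euler f * g + f * fps_euler g.
Proof.
apply: fpsP => k; rewrite fcoD !fcoM /= -big_split /= mulr_sumr.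
apply: eq_bigr => i _.
have -> : k%:R = i%:R + (k - i)%:R :> L by rewrite -natrD subnKC // -ltnS.
by ring.
Qed.

Definition laurC (c : L) : F := (fpsC c)%:F.
HB.instance Definition _ := GRing.RMorphism.copy laurC
  (@FracField.tofrac (fps L) \o @fpsC L).

Definition laurT : F := (fpsX L)%:F.

Lemma laurT_neq0 : laurT != 0.
Proof. by rewrite tofrac_eq0; have := fpsXn_neq0 L 1; rewrite expr1. Qed.

Lemma laurTXz_neq0 n : laurT ^ n != 0.
Proof. exact/expfz_neq0/laurT_neq0. Qed.

Lemma laurTD n m : laurT ^ (n + m) = laurT ^ n * laurT ^ m.
Proof. exact/expfzDr/laurT_neq0. Qed.

(** Valuation at least [n], phrased as membership in [t^n L[[t]]], so that 0 needs no value of its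
    own. *)
Definition vge n x := exists f, x = f%:F * laurT ^ n.

Lemma vge0 n : vge n 0.
Proof. by exists 0; rewrite tofrac0 mul0r. Qed.

Lemma vge_tofrac f : vge 0 f%:F.
Proof. by exists f; rewrite mulr1. Qed.

Lemma vgeM n m x y : vge n x -> vge m y -> vge (n + m) (x * y).
Proof.
move=> [f ->] [g ->]; exists (f * g); rewrite tofracM laurTD.
by rewrite mulrACA.
Qed.

Lemma vgeD n x y : vge n x -> vge n y -> vge n (x + y).
Proof. by move=> [f ->] [g ->]; exists (f + g); rewrite tofracD mulrDl. Qed.

Lemma vgeN n x : vge n x -> vge n (- x).
Proof. by move=> [f ->]; exists (- f); rewrite tofracN mulNr. Qed.

Lemma vge_laurT n : vge n (laurT ^ n).
Proof. by exists 1; rewrite tofrac1 mul1r. Qed.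

Lemma vge_le n m x : m <= n -> vge n x -> vge m x.
Proof.
move=> le_mn [f ->]; have -> : n = `|n - m|%N%:Z + m by lia.
exists (f * fpsX L ^+ `|n - m|); rewrite laurTD tofracM tofracXn mulrA.
by [].
Qed.

Lemma vge_sum n I (r : seq I) (P : pred I) (G : I -> F) :
  (forall i, P i -> vge n (G i)) -> vge n (\sum_(i <- r | P i) G i).
Proof. by move=> vG; elim/big_ind: _ => //; [apply: vge0|apply: vgeD]. Qed.

Lemma vge_exp n x k : vge n x -> vge (n * k%:Z) (x ^+ k).
Proof.
move=> vx; elim: k => [|k IHk]; first by rewrite mulr0; apply: vge_tofrac.
have -> : n * k.+1%:Z = n + n * k%:Z by lia.
by rewrite exprS; apply: vgeM.
Qed.

Lemma vge_fco n f k : vge n f%:F -> k%:Z < n -> fco f k = 0.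
Proof.
move=> [g] + lt_kn; have -> : n = `|n|%N%:Z by lia.
rewrite -[laurT ^ _]tofracXn -tofracM => /eqP; rewrite tofrac_eq => /eqP ->.
by rewrite mulrC fco_XnM ifT //; lia.
Qed.

(** Valuation exactly [n]: the upper bound is a lower bound for the inverse, which makes the product
    rule immediate. *)
Definition hasval n x := [/\ x != 0, vge n x & vge (- n) x^-1].

Lemma hasvalM n m x y : hasval n x -> hasval m y -> hasval (n + m) (x * y).
Proof.
move=> [nx vx vx'] [ny vy vy']; split; first by rewrite mulf_neq0.
  exact: vgeM.
by rewrite opprD invfM; apply: vgeM.
Qed.

Lemma hasval1 : hasval 0 1.
Proof.
by split; rewrite ?oner_eq0 ?invr1 ?oppr0 // -tofrac1; apply: vge_tofrac.
Qed.

Lemma hasvalX n x k : hasval n x -> hasval (n * k%:Z) (x ^+ k).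
Proof.
move=> vx; elim: k => [|k IHk]; first by rewrite mulr0; apply: hasval1.
have -> : n * k.+1%:Z = n + n * k%:Z by lia.
by rewrite exprS; apply: hasvalM.
Qed.

Lemma hasval_prod (I : finType) (nu : I -> int) (G : I -> F) :
  (forall i, hasval (nu i) (G i)) -> hasval (\sum_i nu i) (\prod_i G i).
Proof.
move=> vG; elim/big_rec2: _ => [|i n x _]; first exact: hasval1.
exact: hasvalM.
Qed.

Lemma hasval_unit f n : fco f 0 != 0 -> hasval n (f%:F * laurT ^ n).
Proof.
move=> f0; have uf : f \is a GRing.unit by [].
have nzf : f%:F != 0.
  by rewrite tofrac_eq0; apply: contraNneq f0 => ->.
split; first by rewrite mulf_neq0 ?laurTXz_neq0.
  by exists f.
exists f^-1; rewrite invfM -invr_expz; congr (_ * _).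
apply: (mulfI nzf); rewrite mulfV // -tofracM mulrV //.
Qed.

Lemma hasval_laurT n : hasval n (laurT ^ n).
Proof.
rewrite -[_ ^ n]mul1r -tofrac1; apply: hasval_unit.
by rewrite fco1 oner_eq0.
Qed.

Lemma hasval_ex x : x != 0 -> exists n, hasval n x.
Proof.
have hasval_fps f : f != 0 -> exists n, hasval n f%:F.
  move=> /fps_orderP[k [u [u0 ->]]]; exists k%:Z.
  by rewrite tofracM tofracXn; apply: hasval_unit.
rewrite (frac_numden x); set a := \n_(_); set b := \d_(_) => nzab.
have [|n [na va va']] := hasval_fps a.
  by apply: contraNneq nzab => ->; rewrite tofrac0 mul0r.
have [|m [nb vb vb']] := hasval_fps b; first exact: denom_ratioP.
exists (n - m); apply: hasvalM; split; rewrite ?invr_neq0 ?invrK ?opprK //.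
Qed.

(* [(t d/dt) / e], which for [e = E] is [X d/dX] with [X = t ^ E]. *)
Definition laur_deriv (e : L) x := laurC e^-1 * frac_deriv fps_euler x.

Section Deriv.
Variable e : L.
Local Notation D := (laur_deriv e).

Lemma laur_derivD : {morph D : x y / x + y}.
Proof.
move=> x y; rewrite /laur_deriv (frac_derivD fps_eulerD fps_eulerM).
by rewrite mulrDr.
Qed.

Lemma laur_derivM x y : D (x * y) = D x * y + x * D y.
Proof. by rewrite /laur_deriv (frac_derivM fps_eulerM); ring. Qed.

Lemma laur_derivC c : D (laurC c) = 0.
Proof.
rewrite /laur_deriv (frac_deriv_tofrac fps_eulerM).
suff -> : fps_euler (fpsC c) = 0 by rewrite tofrac0 mulr0.
by apply: fpsP => -[|k] /=; rewrite ?mul0r ?mulr0.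
Qed.

Lemma laur_derivXn x k : D (x ^+ k) = k%:R * x ^+ k.-1 * D x.
Proof.
elim: k => [|k IHk].
  by rewrite expr0 -(rmorph1 laurC) laur_derivC !mul0r.
rewrite exprS laur_derivM IHk; case: k {IHk} => [|k] /=; first by ring.
by rewrite -[k.+2%:R]natr1 exprS; ring.
Qed.

Lemma laur_deriv_T : D laurT = laurC e^-1 * laurT.
Proof.
rewrite /laur_deriv (frac_deriv_tofrac fps_eulerM); congr (_ * _%:F).
by apply: fpsP => k /=; case: eqP => [->|_]; rewrite ?mulr0 ?mulr1.
Qed.

Lemma laur_deriv_TXn (k : nat) : e != 0 -> k%:R = e -> D (laurT ^+ k) = laurT ^+ k.
Proof.
move=> nze; rewrite laur_derivXn laur_deriv_T; case: k => [|k] kE /=.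
  by rewrite -kE eqxx in nze.
rewrite -(rmorph_nat laurC) kE mulrCA !mulrA -rmorphM mulVf // rmorph1 mul1r.
by rewrite -exprSr.
Qed.

(** The Euler operator multiplies each coefficient by its exponent, so it never lowers the order;
    for [f * t^n] this follows from the product rule. *)
Lemma vge_deriv n x : vge n x -> vge n (D x).
Proof.
have vC c y m : vge m y -> vge m (laurC c * y).
  by move=> vy; rewrite -[m]add0r; apply: vgeM => //; apply: vge_tofrac.
have vDn m : vge m (D (laurT ^ m)).
  case: m => k.
    rewrite -exprnP laur_derivXn laur_deriv_T; case: k => [|k] /=.
      by rewrite !mul0r; apply: vge0.
    rewrite mulrCA; apply: (vC); rewrite -mulrA -exprSr -(rmorph_nat laurC).
    apply: (vC); exact: (vge_laurT k.+1).
  (* Negative powers of [t] are reached by differentiating [t^(k+1) * t^(-(k+1)) = 1]. *)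
  have /(congr1 D) : laurT ^+ k.+1 * laurT ^ (Negz k) = 1.
    by rewrite NegzE -exprnN mulfV // expf_neq0 ?laurT_neq0.
  rewrite -(rmorph1 laurC) laur_derivC laur_derivM laur_derivXn laur_deriv_T.
  move=> /eqP; rewrite addrC addr_eq0 => /eqP eq0.
  have nz : laurT ^+ k.+1 != 0 by rewrite expf_neq0 ?laurT_neq0.
  have -> : D (laurT ^ Negz k) = - (laurC e^-1 * (laurC k.+1%:R * laurT ^ Negz k)).
    by apply: (mulfI nz); rewrite eq0 /= rmorph_nat exprSr; ring.
  by apply: vgeN; apply: (vC); apply: (vC); apply: vge_laurT.
move=> [f ->]; rewrite laur_derivM; apply: vgeD.
  rewrite /laur_deriv (frac_deriv_tofrac fps_eulerM) -mulrA; apply: (vC).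
  by exists (fps_euler f).
by have := vgeM (vge_tofrac f) (vDn n); rewrite add0r.
Qed.

Hypothesis L0 : [pchar L] =i pred0.

(** Once the pole is cleared, [f = x * t^N] satisfies [t f' = N f], that is [k f_k = N f_k] for all
    [k]; in characteristic 0 only the coefficient [f_N] survives. *)
Lemma laur_deriv_eq0 x : e != 0 -> D x = 0 -> exists c, x = laurC c.
Proof.
move=> nze; have [->|/hasval_ex [n [_ vx _]]] := eqVneq x 0.
  by exists 0; rewrite rmorph0.
have [N [f fE]] : exists N f, f%:F = x * laurT ^+ N.
  exists `|n|%N.
  have [|f] := @vge_le _ 0 (x * laurT ^+ `|n|) _ (vgeM vx (vge_laurT `|n|%N)).
    by lia.
  by rewrite mulr1 => ->; exists f.
have nzT : laurT ^+ N != 0 by rewrite expf_neq0 ?laurT_neq0.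
move=> Dx0; have : D f%:F = laurC e^-1 * (laurC N%:R * f%:F).
  rewrite {1}fE laur_derivM Dx0 mul0r add0r laur_derivXn laur_deriv_T fE.
  rewrite rmorph_nat; case: N {f fE nzT} => [|N] /=; last by rewrite exprSr; ring.
  by rewrite !(mul0r, mulr0).
rewrite /laur_deriv (frac_deriv_tofrac fps_eulerM) => /mulfI.
rewrite fmorph_eq0 invr_eq0 => /(_ nze) /eqP; rewrite -tofracM tofrac_eq => /eqP.
move=> eqf; exists (fco f N); apply: (mulIf nzT); rewrite -fE -tofracXn -tofracM.
congr (_%:F); apply: fpsP => k; rewrite fco_CM fco_Xn.
have := congr1 (@fco _ ^~ k) eqf; rewrite fco_CM /=.
have [->|neq_kN] := eqVneq k N; first by rewrite mulr1.
move=> /eqP; rewrite -subr_eq0 -mulrBl mulf_eq0 mulr0 => /orP[|/eqP//].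
move: L0 => /pcharf0P natr0.
(* The characteristic criterion concerns natural numbers, so the difference of [k] and [N] is taken
   in the order that keeps it natural. *)
wlog: / (N <= k)%N; last first.
  by move=> le_Nk; rewrite -natrB // natr0 subn_eq0; lia.
have [le_Nk|/ltnW le_kN] := leqP N k; first by apply.
by move=> _; rewrite -oppr_eq0 opprB -natrB // natr0 subn_eq0; lia.
Qed.

End Deriv.
End Laurent.

(** * Wronskians and Gauss's lemma *)

(** Every term of the Leibniz expansion takes one entry from each row and each column, so its weight
    is the same for all permutations. [B] covers both lower bounds on valuations and upper bounds on
    degrees. *)
Lemma filtered_det (R : comNzRingType) (M : nmodType) (B : M -> R -> Prop)
    (B0 : forall m, B m 0) (B1 : B 0 1)
    (BD : forall m x y, B m x -> B m y -> B m (x + y))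
    (BN : forall m x, B m x -> B m (- x))
    (BM : forall m k x y, B m x -> B k y -> B (m + k) (x * y))
    n (A : 'M[R]_n) (r c : 'I_n -> M) :
  (forall i j, B (r i + c j) (A i j)) ->
  B (\sum_i r i + \sum_j c j) (\det A).
Proof.
move=> BA; rewrite /determinant; apply: (big_ind (B _)) => [|x y|s _]; first exact: B0.
  exact: BD.
suff : B (\sum_i r i + \sum_j c j) (\prod_i A i (s i)).
  move=> Bs; case: (odd_perm s); rewrite ?expr0 ?mul1r // expr1 mulN1r.
  exact: BN.
have -> : \sum_j c j = \sum_i c (s i) by rewrite (reindex_inj (@perm_inj _ s)).
rewrite -big_split; apply: (big_rec2 B) => [|i m x _ Bmx]; first exact: B1.
exact: BM (BA i (s i)) Bmx.
Qed.

Lemma det_scale_cols (R : comNzRingType) n (A : 'M[R]_n) (m : 'I_n -> R) :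
  \det (\matrix_(i, j) (m j * A i j)) = (\prod_j m j) * \det A.
Proof.
have -> : \matrix_(i, j) (m j * A i j) = A *m diag_mx (\row_j m j).
  apply/matrixP => i j; rewrite mul_mx_diag !mxE mulrC //.
rewrite det_mulmx det_diag mulrC; congr (_ * _).
by apply: eq_bigr => j _; rewrite mxE.
Qed.

(** Cramer's rule: the new matrix is [A] times the identity matrix whose column [j0] is replaced by
    [c]. *)
Lemma det_replace_col (R : comNzRingType) n (A : 'M[R]_n) (c : 'I_n -> R) j0 :
  \det (\matrix_(i, j) (if j == j0 then \sum_k c k * A i k else A i j))
  = c j0 * \det A.
Proof.
pose M := \matrix_(k, j) (if j == j0 then c k else (k == j)%:R : R).
have -> : \matrix_(i, j) (if j == j0 then \sum_k c k * A i k else A i j) = A *m M.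
  apply/matrixP => i j; rewrite !mxE; case: (eqVneq j j0) => [->|nj].
    by apply: eq_bigr => k _; rewrite mxE eqxx mulrC.
  rewrite (bigD1 j) //= mxE (negbTE nj) eqxx mulr1 big1 ?addr0 // => k nkj.
  by rewrite mxE (negbTE nj) (negbTE nkj) mulr0.
rewrite det_mulmx mulrC; congr (_ * _).
rewrite (expand_det_row M j0) (bigD1 j0) //= mxE eqxx big1 => [|j nj]; last first.
  by rewrite mxE (negbTE nj) eq_sym (negbTE nj) mul0r.
rewrite addr0 /cofactor -signr_odd addnn odd_double expr0 mul1r.
suff -> : row' j0 (col' j0 M) = 1%:M by rewrite det1 mulr1.
apply/matrixP => i j; rewrite !mxE eq_sym (negbTE (neq_lift _ _)).
by rewrite (inj_eq lift_inj).
Qed.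

Section Wronskian.
Variables (F : fieldType) (D : F -> F).
Hypothesis DD : {morph D : x y / x + y}.
Hypothesis DM : forall x y, D (x * y) = D x * y + x * D y.

Lemma derivation1 : D 1 = 0.
Proof.
have := DM 1 1; rewrite !mulr1 mul1r => /eqP.
by rewrite -subr_eq0 opprD addrA subrr add0r oppr_eq0 => /eqP.
Qed.

Lemma derivation0 : D 0 = 0.
Proof. by apply: (addrI (D 0)); rewrite -DD !addr0. Qed.

Lemma derivation_sum I (r : seq I) (P : pred I) (f : I -> F) :
  D (\sum_(i <- r | P i) f i) = \sum_(i <- r | P i) D (f i).
Proof. exact: (big_morph D DD derivation0). Qed.

Lemma lift_widen n (k : 'I_n) : lift ord_max k = widen_ord (leqnSn n) k.
Proof. by apply/val_inj; rewrite [LHS]lift_max. Qed.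

(** Induction on [n]. If the Wronskian of the first [n] functions vanishes, their relation is padded
    with 0. Otherwise a kernel vector is normalised to have last coordinate 1, and differentiating
    its relations shows that its derivative lies in the kernel of an invertible matrix. *)
Lemma wronskian_eq0_dep n (f : 'I_n -> F) :
  \det (\matrix_(i < n, j < n) iter i D (f j)) = 0 ->
  exists2 c : 'I_n -> F, exists j, c j != 0 &
    (forall j, D (c j) = 0) /\ \sum_j c j * f j = 0.
Proof.
elim: n f => [|n IHn] f; first by rewrite det_mx00 => /eqP; rewrite oner_eq0.
pose f' j := f (widen_ord (leqnSn n) j).
have [/IHn [c [j cj] [cD cf]] _|W'] :=
    eqVneq (\det (\matrix_(i < n, j < n) iter i D (f' j))) 0.
  pose c' (k : 'I_n.+1) := if unlift ord_max k is Some k' then c k' else 0.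
  have c'W k : c' (widen_ord (leqnSn n) k) = c k.
    rewrite /c'; rewrite -lift_widen.
    by rewrite liftK.
  have c'M : c' ord_max = 0 by rewrite /c' unlift_none.
  exists c'; first by exists (widen_ord (leqnSn n) j); rewrite c'W.
  split => [k|]; first by rewrite /c'; case: unlift => [?|]; rewrite ?derivation0.
  rewrite big_ord_recr /= c'M mul0r addr0 -[RHS]cf.
  by apply: eq_bigr => k _; rewrite c'W.
have W'_inj (u : 'I_n -> F) :
    (forall i : 'I_n, \sum_j u j * iter i D (f' j) = 0) -> forall j, u j = 0.
  move=> uf j; apply/eqP; apply: contraNT W' => uj; rewrite -det_tr.
  apply/det0P; exists (\row_k u k).
    by apply: contraNneq uj => /rowP/(_ j); rewrite !mxE => ->.
  apply/rowP => i; rewrite !mxE -[RHS](uf i).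
  by apply: eq_bigr => k _; rewrite !mxE.
rewrite -det_tr => /eqP/det0P[v nzv vf0].
have vf (i : 'I_n.+1) : \sum_j v 0 j * iter i D (f j) = 0.
  have /rowP/(_ i) := vf0; rewrite !mxE => vi; rewrite -[RHS]vi.
  by apply: eq_bigr => k _; rewrite !mxE.
have vM : v 0 ord_max != 0.
  apply: contraNneq nzv => vM; apply/eqP/rowP => j; rewrite [RHS]mxE.
  have v0 := W'_inj (fun k => v 0 (widen_ord (leqnSn n) k)).
  case: (unliftP ord_max j) => [k ->|-> //].
  rewrite lift_widen.
  apply: v0 => i; have := vf (widen_ord (leqnSn n) i).
  by rewrite big_ord_recr /= vM mul0r addr0.
pose c j := v 0 j / v 0 ord_max.
have cf (i : 'I_n.+1) : \sum_j c j * iter i D (f j) = 0.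
  rewrite (eq_bigr (fun j => (v 0 ord_max)^-1 * (v 0 j * iter i D (f j)))).
    by rewrite -mulr_sumr vf mulr0.
  by move=> j _; rewrite /c; ring.
have cM : c ord_max = 1 by rewrite /c divff.
exists c; first by exists ord_max; rewrite cM oner_eq0.
split; last by have := cf ord0.
move=> j; case: (unliftP ord_max j) => [k ->|->]; last by rewrite cM derivation1.
rewrite lift_widen.
apply: (W'_inj (fun k => D (c (widen_ord (leqnSn n) k)))) => i.
have /(congr1 D) := cf (widen_ord (leqnSn n) i).
rewrite derivation0 derivation_sum; under eq_bigr do rewrite DM.
(* The part without derivatives of the [c j] is the relation of index [i.+1], which is still
   available because [i < n]. *)
rewrite big_split /= -[X in _ + X]/(\sum_j c j * iter i.+1 D (f j)).
have -> : \sum_j c j * iter i.+1 D (f j) = 0.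
  by have lt_in : (i.+1 < n.+1)%N := ltn_ord i; have := cf (Ordinal lt_in).
by rewrite addr0 big_ord_recr /= cM derivation1 mul0r addr0.
Qed.
End Wronskian.

(** * Gauss's lemma over [K[X]] *)

Section Gauss.
Variable K : fieldType.
Implicit Types (p q r : {poly K}) (g h k : {poly {poly K}}).

Lemma irreducible_dvdM p q r :
  irreducible_poly p -> p %| q * r -> (p %| q) || (p %| r).
Proof.
move=> irr_p dvd_p; have [//|ndvd_pq /=] := boolP (p %| q).
rewrite -(Gauss_dvdpr r (_ : coprimep p q)) //.
have sz1 : size (gcdp p q) = 1%N.
  apply/eqP; apply: contraNT ndvd_pq => sz.
  by have := irr_p.2 _ sz (dvdp_gcdl p q) => /eqp_dvdl <-; apply: dvdp_gcdr.
by rewrite /coprimep sz1.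
Qed.

Lemma irreducible_factor_ex p : (1 < size p)%N ->
  exists2 q, irreducible_poly q & q %| p.
Proof.
have [n] := ubnP (size p); elim: n p => // n IHn p lt_pn p_gt1.
have [[q dvd_qp [q_neq1 nqp]]|irr] :=
    pselect (exists2 q, q %| p & size q != 1%N /\ ~~ (q %= p)).
  have nzp : p != 0 by rewrite -size_poly_gt0; apply: ltnW.
  have nzq : q != 0 by apply: contraTneq dvd_qp => ->; rewrite dvd0p.
  have lt_qp : (size q < size p)%N.
    by rewrite ltn_neqAle dvdp_leq // andbT -dvdp_size_eqp in nqp *.
  have [||r irr_r dvd_rq] := IHn q; first by apply: leq_trans lt_qp _.
    by rewrite ltn_neqAle eq_sym q_neq1 size_poly_gt0.
  by exists r => //; apply: dvdp_trans dvd_rq dvd_qp.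
exists p => //; split=> // q q_neq1 dvd_qp.
by apply: contrapT => /negP nqp; apply: irr; exists q.
Qed.

(** If [i] and [j] are the first indices whose coefficients in [h] and [k] escape [p], then
    coefficient [i + j] of the product is [h]_i * k[_j] plus multiples of [p]. *)
Lemma irreducible_dvd_coefM p h k : irreducible_poly p ->
  (forall i, p %| (h * k)`_i) ->
  (forall i, p %| h`_i) \/ (forall i, p %| k`_i).
Proof.
move=> irr_p dvd_hk; apply: contrapT => /not_orP[/existsNP exh /existsNP exk].
have ex_min (u : {poly {poly K}}) : (exists i, ~ p %| u`_i) ->
    exists2 i, ~~ (p %| u`_i) & forall j, (j < i)%N -> p %| u`_j.
  move=> [i /negP ui]; have ex : exists i, ~~ (p %| u`_i) by exists i.
  case: (ex_minnP ex) => m um min_m; exists m => // j lt_jm.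
  by apply: contraTT lt_jm => /min_m; rewrite -leqNgt.
have [i ndvd_hi dvd_h] := ex_min _ exh; have [j ndvd_kj dvd_k] := ex_min _ exk.
have := dvd_hk (i + j)%N; rewrite coefM.
have lt_i : (i < (i + j).+1)%N by rewrite ltnS leq_addr.
rewrite (bigD1 (Ordinal lt_i)) //= addKn dvdp_addl; last first.
  rewrite big_seq_cond; elim/big_ind: _ => [||m /andP[_ neq_mi]]; first exact: dvdp0.
    by move=> ? ? ? ?; apply: dvdp_add.
  have [lt_mi|] := ltnP m i; first by rewrite dvdp_mulr ?dvd_h.
  rewrite leq_eqVlt => /orP[/eqP e|lt_im].
    by case/eqP: neq_mi; apply: val_inj.
  by rewrite dvdp_mull // dvd_k //; have := ltn_ord m; lia.
by move/(irreducible_dvdM irr_p); rewrite (negbTE ndvd_hi) (negbTE ndvd_kj).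
Qed.

Lemma coef_dvd_divisible p h : p != 0 -> (forall i, p %| h`_i) ->
  exists2 h', h = p *: h' & size h' = size h.
Proof.
move=> nzp dvd_h; exists (\poly_(i < size h) (h`_i %/ p)).
  apply/polyP => i; rewrite coefZ coef_poly; case: ltnP => [_|?].
    by rewrite mulrC divpK.
  by rewrite nth_default // mulr0.
have [->|nzh] := eqVneq h 0; first by rewrite size_poly0 poly_def big_ord0 size_poly0.
rewrite size_poly_eq // divpN0 // dvdp_leq ?lead_coef_eq0 //.
Qed.

Lemma scalerI_poly p : p != 0 -> injective (fun g => p *: g).
Proof.
move=> nzp g h /polyP e; apply/polyP => i.
by have := e i; rewrite !coefZ => /(mulfI nzp).
Qed.

(** The irreducible factors of [c] are cancelled one at a time, each against [h] or against [k]; the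
    constant left at the end is absorbed into [h]. Only factors from [K[X]] are removed, so the
    [Y]-degrees are kept. *)
Lemma gauss_factor (c : {poly K}) g h k : c != 0 -> c *: g = h * k ->
  exists h' k', [/\ g = h' * k', size h' = size h & size k' = size k].
Proof.
have [n] := ubnP (size c); elim: n c h k => // n IHn c h k lt_cn nzc cg.
have [c_gt1|] := ltnP 1 (size c); last first.
  move=> /size1_polyC cE; set c0 := c`_0 in cE.
  have nzc0 : c0 != 0 by apply: contraNneq nzc; rewrite cE => ->.
  exists (c0^-1%:P *: h), k; split=> //.
    by rewrite -scalerAl -cg scalerA cE -polyCM mulVf // scale1r.
  by rewrite size_scale // polyC_eq0 invr_eq0.
have [p irr_p dvd_pc] := irreducible_factor_ex c_gt1.
have nzp := irredp_neq0 irr_p.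
have cE := divpK dvd_pc; set c' := c %/ p in cE.
have nzc' : c' != 0 by apply: contraNneq nzc; rewrite -cE => ->; rewrite mul0r.
have lt_c'n : (size c' < n)%N.
  have p_gt1 : (1 < size p)%N := irr_p.1.
  have := size_mul nzc' nzp; rewrite cE; move: lt_cn p_gt1.
  by move: (size c) (size c') (size p) => x y z; lia.
have dvd_hk i : p %| (h * k)`_i by rewrite -cg coefZ dvdp_mulr.
case: (irreducible_dvd_coefM irr_p dvd_hk) => /(coef_dvd_divisible nzp) [u uE <-].
  apply: (IHn c') => //; apply: (scalerI_poly nzp).
  by rewrite scalerA mulrC cE cg uE scalerAl.
apply: (IHn c') => //; apply: (scalerI_poly nzp).
by rewrite scalerA mulrC cE cg uE scalerAr.
Qed.
End Gauss.

(** * Bidegrees and resultants *)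

Section Resultant.
Variable K : fieldType.
Implicit Types (p c : {poly K}) (A B P g : {poly {poly K}}).

(** The outer size controls the degree in [Y], the sizes of the coefficients that in [X]; one [n]
    for both gives a filtration to which [filtered_det] applies. *)
Definition bideg_le (n : nat) A :=
  (size A <= n.+1)%N /\ forall i, (size (A`_i)%R <= n.+1)%N.

Lemma bideg_le0 n : bideg_le n 0.
Proof. by split=> [|i]; rewrite ?coef0 size_poly0. Qed.

Lemma bideg_le1 : bideg_le 0 1.
Proof.
split=> [|i]; first by rewrite size_poly1.
by rewrite coef1; case: eqP; rewrite ?size_poly1 // size_poly0.
Qed.

Lemma bideg_leD n A B : bideg_le n A -> bideg_le n B -> bideg_le n (A + B).
Proof.
move=> [sA cA] [sB cB]; split=> [|i].
  by rewrite (leq_trans (size_polyD _ _)) // geq_max sA.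
by rewrite coefD (leq_trans (size_polyD _ _)) // geq_max cA cB.
Qed.

Lemma bideg_leN n A : bideg_le n A -> bideg_le n (- A).
Proof. by move=> [sA cA]; split=> [|i]; rewrite ?coefN size_polyN. Qed.

Lemma size_mul_leS (R : nzRingType) n m (p q : {poly R}) :
  (size p <= n.+1 -> size q <= m.+1 -> size (p * q)%R <= (n + m).+1)%N.
Proof. by move=> ? ?; rewrite (leq_trans (size_polyMleq _ _)) //; lia. Qed.

Lemma bideg_leM n m A B :
  bideg_le n A -> bideg_le m B -> bideg_le (n + m) (A * B).
Proof.
move=> [sA cA] [sB cB]; split=> [|i]; first exact: size_mul_leS.
rewrite coefM (leq_trans (size_sum _ _ _)) //; apply/bigmax_leqP => j _.
exact: size_mul_leS.
Qed.

Lemma bideg_le_natl n k A : bideg_le n A -> bideg_le n (k%:R * A).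
Proof.
move=> bA; rewrite mulr_natl; elim: k => [|k IHk]; first exact: bideg_le0.
by rewrite mulrS; apply: bideg_leD.
Qed.

Lemma bideg_le_tdeg g : bideg_le (tdeg g) g.
Proof.
have le_tdeg i : g`_i != 0 -> ((size (g`_i)%R).-1 + i <= tdeg g)%N.
  move=> nzi; have lt_i : (i < size g)%N.
    by rewrite ltnNge; apply: contra nzi => ?; rewrite nth_default.
  by have /= := leq_bigmax (F := fun i : 'I_(size g) =>
      if g`_i != 0 then ((size (g`_i)%R).-1 + i)%N else 0%N) (Ordinal lt_i); rewrite nzi.
split=> [|i]; last first.
  have [->|/le_tdeg] := eqVneq g`_i 0; first by rewrite size_poly0.
  by lia.
have [->|nzg] := eqVneq g 0; first by rewrite size_poly0.
have := le_tdeg (size g).-1; rewrite -lead_coefE lead_coef_eq0 => /(_ nzg).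
by lia.
Qed.

(** The Sylvester matrix has [(size g).-1] rows filled from [P], of [X]-degree at most [n], and
    [(size P).-1] rows filled from [g], of [X]-degree at most [m]. *)
Lemma size_resultant_le n m P g : bideg_le n P -> bideg_le m g ->
  (size (resultant P g) <= (2 * n * m).+1)%N.
Proof.
move=> [sP cP] [sg cg]; rewrite /resultant.
pose r (i : 'I_((size g).-1 + (size P).-1)) : nat :=
  if split i is inl _ then n else m.
have det_le : (size (\det (Sylvester_mx P g)) <= (\sum_i r i)%R.+1)%N.
  (* The columns carry weight 0, written as a sum of zeros to fit [filtered_det]. *)
  rewrite -[\sum_i r i]addr0 -[X in _ + X](@big1_eq _ _ +%R _
    (index_enum 'I_((size g).-1 + (size P).-1)) predT).
  apply: (@filtered_det _ nat (fun k (p : {poly K}) => is_true (size p <= k.+1)%N)).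
  - by move=> k; rewrite size_poly0.
  - by rewrite size_poly1.
  - by move=> k p q ? ?; rewrite (leq_trans (size_polyD _ _)) // geq_max; apply/andP.
  - by move=> k p ?; rewrite size_polyN.
  - by move=> k l p q; apply: size_mul_leS.
  move=> i j; rewrite Sylvester_mxE /r addr0.
  by case: split => k /=; case: (k <= j)%N; rewrite ?mulr1n ?mulr0n ?size_poly0 ?cP ?cg.
apply: leq_trans det_le _.
have -> : \sum_i r i = ((size g).-1 * n + (size P).-1 * m)%N.
  rewrite big_split_ord /= /r.
  under eq_bigr do rewrite (unsplitK (inl _)).
  under [X in _ + X]eq_bigr do rewrite (unsplitK (inr _)).
  have mulrnE (x k : nat) : x *+ k = (k * x)%N by rewrite -mulr_natl natn.
  by rewrite !sumr_const !card_ord !mulrnE.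
rewrite ltnS; have : ((size g).-1 * n <= m * n)%N by rewrite leq_mul2r; lia.
have : ((size P).-1 * m <= n * m)%N by rewrite leq_mul2r; lia.
by nia.
Qed.

(** The gcd divides [g] only up to a factor [c] in [K[X]]. Gauss's lemma turns this into a true
    factorisation of [g] with the same [Y]-degrees, and irreducibility makes the cofactor constant
    in [Y]. *)
Lemma irreducible_gcd P g : irreducible_elt g -> (1 < size (gcdp P g))%N ->
  exists c k : {poly K}, [/\ c != 0, k != 0 & c *: g = k *: gcdp P g].
Proof.
move=> [nzg [_ irr_g]] gt1; set h := gcdp P g in gt1 *.
have /Pdiv.Idomain.dvdpP[[c q] /= nzc cg] : h %| g by apply: dvdp_gcdr.
have [q' [h' [gE sq sh]]] := gauss_factor nzc cg.
exists c, q`_0.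
have sq1 : (size q <= 1)%N.
  case: (irr_g _ _ gE); rewrite poly_unitE => /andP[/eqP s1 _].
    by rewrite -sq s1.
  by rewrite -sh s1 in gt1.
have qE := size1_polyC sq1.
split=> //; last by rewrite cg {1}qE mul_polyC.
apply: contraNneq nzg => q0; rewrite qE q0 mul0r in cg.
by move/eqP: cg; rewrite scale_poly_eq0 (negbTE nzc).
Qed.

Variables (F : fieldType) (ev : {rmorphism {poly {poly K}} -> F}).
Variable g : {poly {poly K}}.
Hypothesis irr_g : irreducible_elt g.
Hypothesis g_gt1 : (1 < size g)%N.
Hypothesis ev_g : ev g = 0.
Hypothesis ev_inj : forall c : {poly K}, ev c%:P = 0 -> c = 0.

(** From [R = U * P + V * g] only [U * P] survives the evaluation. If [R] were 0, the gcd would be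
    [g] up to factors in [K[X]]; it would then force [ev P = 0], and it would be at least as long as
    [g]. The disjunction in the hypotheses offers either contradiction. *)
Lemma ev_coprime P : (1 < size P)%N ->
  ev P != 0 \/ (size P < size g)%N -> P != 0 ->
  exists (R : {poly K}) (U : {poly {poly K}}),
    [/\ R != 0, R = resultant P g, (size U < size g)%N & ev R%:P = ev U * ev P].
Proof.
move=> P_gt1 Pg nzP; exists (resultant P g).
have [[U V] /= [sU _] RE] := resultant_in_ideal P_gt1 g_gt1.
exists U; split=> //; last by rewrite RE rmorphD !rmorphM ev_g mulr0 addr0.
rewrite resultant_eq0 -leqNgt leqNgt; apply/negP => gcd_gt1.
have [c [k [nzc nzk cg]]] := irreducible_gcd irr_g gcd_gt1.
case: Pg => [|lt_Pg]; last first.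
  have : (size (gcdp P g) <= size P)%N by rewrite dvdp_leq ?dvdp_gcdl.
  by rewrite -(size_scale (gcdp P g) nzk) -cg size_scale // leqNgt lt_Pg.
have evh : ev (gcdp P g) = 0.
  apply/eqP; have /(congr1 ev) := cg; rewrite -!mul_polyC !rmorphM ev_g mulr0.
  move=> /esym/eqP; rewrite mulf_eq0 => /orP[/eqP/ev_inj k0|//].
  by rewrite k0 eqxx in nzk.
have /Pdiv.Idomain.dvdpP[[c' q] /= nzc' cP] : gcdp P g %| P by apply: dvdp_gcdl.
have /(congr1 ev) := cP; rewrite -mul_polyC !rmorphM evh mulr0 => /eqP.
by rewrite mulf_eq0 => /orP[/eqP/ev_inj c'0|->//]; rewrite c'0 eqxx in nzc'.
Qed.

(** The derivative has smaller [Y]-degree than [g], hence is coprime to it. A derivative constant in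
    [Y] is handled apart, since the resultant identity asks for positive [Y]-degree. *)
Lemma ev_deriv_neq0 : g^`() != 0 -> ev g^`() != 0.
Proof.
move=> nzg'; have [g'_gt1|] := ltnP 1 (size g^`()).
  have [|R [U [nzR _ _ RE]]] := ev_coprime g'_gt1 _ nzg'.
    by right; rewrite lt_size_deriv // -size_poly_gt0 ltnW.
  apply: contraNneq nzR => evg'; apply/eqP/ev_inj.
  by rewrite RE evg' mulr0.
move=> /size1_polyC g'E; apply: contraNneq nzg' => evg'.
by rewrite g'E in evg' *; rewrite (ev_inj evg').
Qed.
End Resultant.

(** * Euler operators and the tangent derivation on [K[X][Y]] *)

Section EulerOperators.

Lemma coef_Xderiv (R : nzRingType) (p : {poly R}) i :
  ('X * p^`())`_i = p`_i *+ i.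
Proof. by rewrite coefXM; case: i => [|i] //=; rewrite coef_deriv. Qed.

Lemma size_Xderiv (R : nzRingType) (p : {poly R}) :
  (size ('X * p^`())%R <= size p)%N.
Proof.
by apply/leq_sizeP => i le_pi; rewrite coef_Xderiv nth_default // mul0rn.
Qed.

Variable K : fieldType.
Implicit Types (p c : {poly K}) (A B P g : {poly {poly K}}).

Definition eulerX A := map_poly (fun p : {poly K} => 'X * p^`()) A.
Definition eulerY A := 'X * A^`().

Lemma coef_eulerX A i : (eulerX A)`_i = 'X * (A`_i)^`().
Proof. by rewrite coef_map_id0 // deriv0 mulr0. Qed.

Lemma bideg_le_eulerX n A : bideg_le n A -> bideg_le n (eulerX A).
Proof.
move=> [sA cA]; split=> [|i]; first exact: leq_trans (size_poly _ _) sA.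
by rewrite coef_eulerX (leq_trans (size_Xderiv _)).
Qed.

Lemma bideg_le_eulerY n A : bideg_le n A -> bideg_le n (eulerY A).
Proof.
move=> [sA cA]; split=> [|i]; first exact: leq_trans (size_Xderiv _) sA.
rewrite coef_Xderiv -mulr_natl (leq_trans (size_polyMleq _ _)) //.
rewrite -polyC_natr; have := size_polyC_leq1 (i%:R : K).
by have := cA i; move: (size _) (size _); lia.
Qed.

Lemma eulerXD : {morph eulerX : A B / A + B}.
Proof.
by move=> A B; apply/polyP => i; rewrite !(coef_eulerX, coefD) derivD mulrDr.
Qed.

Lemma eulerXM A B : eulerX (A * B) = eulerX A * B + A * eulerX B.
Proof.
apply/polyP => i; rewrite coefD coef_eulerX !coefM raddf_sum mulr_sumr.
rewrite -big_split /=; apply: eq_bigr => j _; rewrite !coef_eulerX derivM.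
by ring.
Qed.

Lemma eulerYD : {morph eulerY : A B / A + B}.
Proof. by move=> A B; rewrite /eulerY derivD mulrDr. Qed.

Lemma eulerYM A B : eulerY (A * B) = eulerY A * B + A * eulerY B.
Proof. by rewrite /eulerY derivM; ring. Qed.

Lemma eulerXC p : eulerX p%:P = ('X * p^`())%:P.
Proof. by apply/polyP => i; rewrite coef_eulerX !coefC; case: eqP; rewrite ?deriv0 ?mulr0. Qed.

Lemma eulerYC p : eulerY p%:P = 0.
Proof. by rewrite /eulerY derivC mulr0. Qed.

Lemma eulerX_Y : eulerX 'X = 0.
Proof.
apply/polyP => i; rewrite coef_eulerX coefX coef0.
by case: eqP; rewrite ?deriv0 ?mulr0 // -[1%:R]/(1%:P) derivC mulr0.
Qed.

Lemma eulerY_Y : eulerY 'X = 'X.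
Proof. by rewrite /eulerY derivX mulr1. Qed.

(* This kills [g], hence descends to the curve [g = 0]; thanks to the Euler
   operators it raises the bidegree by at most that of [g]. *)
Definition tangent g A := eulerY g * eulerX A - eulerX g * eulerY A.

Lemma tangentM g A B :
  tangent g (A * B) = tangent g A * B + A * tangent g B.
Proof. by rewrite /tangent eulerXM eulerYM; ring. Qed.

Lemma tangent_exp g A n :
  tangent g (A ^+ n) = n%:R * A ^+ n.-1 * tangent g A.
Proof.
elim: n => [|n IHn].
  by rewrite expr0 /tangent (eulerXC 1) (eulerYC 1) -[1]/(1%:P) derivC !(mulr0,mul0r) subrr.
rewrite exprS tangentM IHn; case: n {IHn} => [|n] /=; first by ring.
by rewrite -[n.+2%:R]natr1 exprS; ring.
Qed.

Definition monom (a b : nat) : {poly {poly K}} := ('X ^+ a)%:P * 'X ^+ b.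

(** The logarithmic derivative of [X^a Y^b] under [tangent g]. *)
Definition tangent_mult g a b := a%:R * eulerY g - b%:R * eulerX g.

Lemma tangent_monom g a b :
  tangent g (monom a b) = monom a b * tangent_mult g a b.
Proof.
rewrite /monom rmorphXn tangentM !tangent_exp.
have -> : tangent g 'X%:P = eulerY g * 'X%:P.
  by rewrite /tangent eulerXC eulerYC derivX mulr1 mulr0 subr0.
have -> : tangent g 'X = - eulerX g * 'X.
  by rewrite /tangent eulerX_Y eulerY_Y mulr0 add0r mulNr.
rewrite /tangent_mult; case: a => [|a]; case: b => [|b] /=; rewrite ?exprS; ring.
Qed.

(** The cofactor [Q_i] of the monomial in its [i]-th derivative; the recursion is the product rule
    for the monomial times [Q_i]. *)
Fixpoint tangent_coef g a b i : {poly {poly K}} :=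
  if i is i'.+1 then
    tangent_mult g a b * tangent_coef g a b i' + tangent g (tangent_coef g a b i')
  else 1.

Lemma iter_tangent_monom g a b i :
  iter i (tangent g) (monom a b) = monom a b * tangent_coef g a b i.
Proof.
elim: i => [|i IHi] /=; first by rewrite mulr1.
by rewrite IHi tangentM tangent_monom; ring.
Qed.

Lemma bideg_le_tangent_coef n g a b i :
  bideg_le n g -> bideg_le (i * n) (tangent_coef g a b i).
Proof.
move=> bg; elim: i => [|i IHi]; first exact: bideg_le1.
rewrite mulSn /=; apply: bideg_leD.
  apply: bideg_leM => //; apply: bideg_leD; last apply: bideg_leN.
    exact/bideg_le_natl/bideg_le_eulerY.
  exact/bideg_le_natl/bideg_le_eulerX.
apply: bideg_leD; last apply: bideg_leN; apply: bideg_leM.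
- exact: bideg_le_eulerY.
- exact: bideg_le_eulerX.
- exact: bideg_le_eulerX.
- exact: bideg_le_eulerY.
Qed.

(** Row [i] has weight [i * n], and the row indices below [l] add up to ['C(l, 2)]. *)
Lemma bideg_le_wronskian_coef n g l (a b : 'I_l -> nat) : bideg_le n g ->
  bideg_le ('C(l, 2) * n) (\det (\matrix_(i, j) tangent_coef g (a j) (b j) i)).
Proof.
move=> bg; have := @filtered_det {poly {poly K}} nat (@bideg_le K) (@bideg_le0 K) (@bideg_le1 K)
  (@bideg_leD K) (@bideg_leN K) (@bideg_leM K) _ (\matrix_(i, j) tangent_coef g (a j) (b j) i)
  (fun i => (i * n)%N) (fun _ => 0%N).
rewrite big1_eq addr0 -bin2_sum big_mkord big_distrl; apply=> i j.
by rewrite mxE addr0; apply: bideg_le_tangent_coef.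
Qed.
End EulerOperators.

(** A derivation along a morphism [f] is determined by its values on constants and on the variable;
    both chain rules below are proved this way. *)
Lemma poly_deriv_ext (R : comNzRingType) (F : comNzRingType)
    (f : {rmorphism {poly R} -> F}) (D1 D2 : {poly R} -> F) :
    {morph D1 : p q / p + q} -> {morph D2 : p q / p + q} ->
    (forall p q, D1 (p * q) = D1 p * f q + f p * D1 q) ->
    (forall p q, D2 (p * q) = D2 p * f q + f p * D2 q) ->
    (forall c, D1 c%:P = D2 c%:P) -> D1 'X = D2 'X ->
  D1 =1 D2.
Proof.
move=> D1D D2D D1M D2M eqC eqX p; elim/poly_ind: p => [|p c IHp].
  by rewrite -polyC0 eqC.
by rewrite D1D D2D D1M D2M IHp eqC eqX.
Qed.

(** * Puiseux series as Laurent series *)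

Section Representation.
Variable L : fieldType.
Local Notation F := {fraction (fps L)}.
Local Notation T := (laurT L).
Implicit Types (f g : fps L) (s u : puis L).

Lemma fps_substD r f g : fps_subst r (f + g) = fps_subst r f + fps_subst r g.
Proof. by apply: fpsP => k; rewrite fcoD /=; case: ifP; rewrite ?addr0. Qed.

Lemma fps_subst_Xn r n : (0 < r)%N ->
  fps_subst r (fpsX L ^+ n) = fpsX L ^+ (r * n).
Proof.
move=> r_gt0; apply: fpsP => k; rewrite /= !fco_Xn; case: ifP => [/dvdnP[q ->]|ndvd].
  by rewrite mulnK // mulnC eqn_pmul2l.
by case: eqP ndvd => // ->; rewrite dvdn_mulr.
Qed.

Lemma fps_subst_comp r q f : (0 < r)%N -> (0 < q)%N ->
  fps_subst r (fps_subst q f) = fps_subst (r * q) f.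
Proof.
move=> r_gt0 q_gt0; apply: fpsP => k /=.
have [/dvdnP[m ->]|ndvd] := boolP (r %| k)%N.
  by rewrite mulnK // [(m * r)%N]mulnC dvdn_pmul2l // divnMl.
by rewrite ifN //; apply: contra ndvd; apply: dvdn_trans; rewrite dvdn_mulr.
Qed.

Lemma zco_shift s r (k : nat) :
  zco s r (k%:Z - (psh s * r)%N%:Z) = fco (fps_subst r (Fps (pco s))) k.
Proof. by rewrite /zco subrK. Qed.

(** In [padd] both summands are shifted by the sum of the two shifts; [m] is the excess that the
    other summand contributes. *)
Lemma zco_shiftD s r m (k : nat) :
  zco s r (k%:Z - (psh s * r + m)%N%:Z)
  = fco (fpsX L ^+ m * fps_subst r (Fps (pco s))) k.
Proof.
rewrite fco_XnM /zco; have -> : k%:Z - (psh s * r + m)%N%:Z + (psh s * r)%N%:Z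
  = k%:Z - m%:Z by lia.
case: ltnP => [lt_km|le_mk]; last by rewrite subzn.
by have -> : k%:Z - m%:Z = Negz (m - k).-1 by lia.
Qed.

Variable E : nat.
Hypothesis E_gt0 : (0 < E)%N.

(** [rep s] is the image of [s] among Laurent series in [t = X^(1/E)], meaningful when the
    denominator of [s] divides [E]; [ram s] is then the [t]-exponent of one step of the grid of
    [s]. *)
Definition ram s := (E %/ (pden s).+1)%N.
Definition rep s : F :=
  (fps_subst (ram s) (Fps (pco s)))%:F * T ^ (- (psh s * ram s)%N%:Z).

Lemma pden_pmul s u : (pden (pmul s u)).+1 = ((pden s).+1 * (pden u).+1)%N.
Proof. by []. Qed.

Lemma pden_padd s u : (pden (padd s u)).+1 = ((pden s).+1 * (pden u).+1)%N.
Proof. by []. Qed.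

Lemma ram_gt0 s : ((pden s).+1 %| E)%N -> (0 < ram s)%N.
Proof. by move=> dvd; rewrite divn_gt0 // dvdn_leq. Qed.

Lemma rep_mul s u : ((pden s).+1 * (pden u).+1 %| E)%N ->
  rep (pmul s u) = rep s * rep u.
Proof.
move=> dvd; have dvdp : ((pden (pmul s u)).+1 %| E)%N by rewrite pden_pmul.
have r_gt0 := ram_gt0 dvdp; set r := ram _ in r_gt0.
have rE : E = (r * ((pden s).+1 * (pden u).+1))%N by rewrite /r /ram pden_pmul divnK.
have rsE : ram s = (r * (pden u).+1)%N by rewrite /ram {1}rE mulnCA mulKn.
have ruE : ram u = (r * (pden s).+1)%N by rewrite /ram {1}rE mulnA mulnK.
have -> : rep (pmul s u) = (fps_subst r (fps_subst (pden u).+1 (Fps (pco s))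
    * fps_subst (pden s).+1 (Fps (pco u))))%:F * T ^ (- (psh (pmul s u) * r)%N%:Z).
  rewrite /rep -/r; congr ((fps_subst _ _)%:F * _); apply: fpsP => k.
  by rewrite fcoM; apply: eq_bigr => i _; rewrite !zco_shift.
rewrite fps_substM // !fps_subst_comp // -rsE -ruE tofracM /rep.
rewrite mulrACA -laurTD -opprD -PoszD; congr (_ * T ^ (- Posz _)).
by rewrite /= rsE ruE; ring.
Qed.

Lemma rep_add s u : ((pden s).+1 * (pden u).+1 %| E)%N ->
  rep (padd s u) = rep s + rep u.
Proof.
move=> dvd; have dvdp : ((pden (padd s u)).+1 %| E)%N by rewrite pden_padd.
have r_gt0 := ram_gt0 dvdp; set r := ram _ in r_gt0.
have rE : E = (r * ((pden s).+1 * (pden u).+1))%N by rewrite /r /ram pden_padd divnK.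
have rsE : ram s = (r * (pden u).+1)%N by rewrite /ram {1}rE mulnCA mulKn.
have ruE : ram u = (r * (pden s).+1)%N by rewrite /ram {1}rE mulnA mulnK.
have -> : rep (padd s u) = (fps_subst r
    (fpsX L ^+ (psh u * (pden s).+1) * fps_subst (pden u).+1 (Fps (pco s))
    + fpsX L ^+ (psh s * (pden u).+1) * fps_subst (pden s).+1 (Fps (pco u))))%:F
    * T ^ (- (psh (padd s u) * r)%N%:Z).
  rewrite /rep -/r; congr ((fps_subst _ _)%:F * _); apply: fpsP => k.
  by rewrite fcoD -!zco_shiftD /= [X in zco u _ (_ - Posz X)]addnC.
rewrite fps_substD !fps_substM // !fps_subst_comp // -rsE -ruE !fps_subst_Xn //.
rewrite tofracD !tofracM mulrDl !tofracXn -!/T /rep; congr (_ + _).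
  rewrite mulrAC mulrC -[T ^+ _]/(T ^ Posz _) -laurTD; congr (_ * T ^ _).
  by rewrite /= rsE; lia.
rewrite mulrAC mulrC -[T ^+ _]/(T ^ Posz _) -laurTD; congr (_ * T ^ _).
by rewrite /= ruE; lia.
Qed.

Lemma rep_scale c s : rep (pscale c s) = laurC c * rep s.
Proof.
rewrite /rep mulrA -tofracM; congr (_%:F * _); apply: fpsP => k.
by rewrite fco_CM /ram /=; case: ifP; rewrite ?mulr0.
Qed.

Lemma rep0 : rep (pzero_s L) = 0.
Proof.
rewrite /rep (_ : fps_subst _ _ = 0) ?tofrac0 ?mul0r //.
by apply: fpsP => k /=; rewrite if_same.
Qed.

Lemma rep_X a : rep (pX L a) = (T ^+ E) ^+ a.
Proof.
rewrite /rep /ram /= divn1 mul0n oppr0 expr0z mulr1 -exprM -tofracXn.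
rewrite -fps_subst_Xn //; congr ((fps_subst _ _)%:F); apply: fpsP => k.
by rewrite fco_Xn /=; case: eqP.
Qed.

Lemma pden_ppow s n : (pden (ppow s n)).+1 = ((pden s).+1 ^ n)%N.
Proof. by elim: n => // n IHn; rewrite [ppow _ _]/= pden_pmul IHn expnS. Qed.

Lemma rep_pow s n : ((pden s).+1 ^ n %| E)%N -> rep (ppow s n) = rep s ^+ n.
Proof.
elim: n => [|n IHn] dvd; first by rewrite rep_X.
rewrite [ppow _ _]/= rep_mul ?pden_ppow -?expnS // IHn ?exprS //.
by apply: dvdn_trans dvd; rewrite expnS dvdn_mull.
Qed.

Lemma pden_psum (ss : seq (puis L)) :
  (pden (psum ss)).+1 = (\prod_(s <- ss) (pden s).+1)%N.
Proof.
elim: ss => [|s ss IHs]; first by rewrite big_nil.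
by rewrite big_cons -IHs [psum _]/= pden_padd.
Qed.

Lemma rep_sum (ss : seq (puis L)) : ((pden (psum ss)).+1 %| E)%N ->
  rep (psum ss) = \sum_(s <- ss) rep s.
Proof.
elim: ss => [|s ss IHs] dvd; first by rewrite big_nil rep0.
rewrite big_cons [psum _]/= rep_add -?IHs //; apply: dvdn_trans dvd.
by rewrite [psum (_ :: _)]/= pden_padd dvdn_mull.
Qed.

Lemma pcoef_grid s (k : nat) :
  pcoef s ((k%:Z - (psh s)%:Z)%:~R / (pden s).+1%:R) = pco s k.
Proof.
rewrite /pcoef divfK ?pnatr_eq0 // denq_int eqxx numq_int /zco muln1 subrK.
by rewrite dvd1n divn1.
Qed.

(** Conversely to [pcoef_grid], the support lies on the grid, so statements over all rational
    exponents reduce to the sequence [pco s]. *)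
Lemma pcoef_neq0 s q : pcoef s q != 0 ->
  exists2 k : nat, q = (k%:Z - (psh s)%:Z)%:~R / (pden s).+1%:R & pcoef s q = pco s k.
Proof.
rewrite /pcoef; case: ifP => [/eqP den1|_]; last by rewrite eqxx.
rewrite /zco muln1; case kE: (_ + _) => [k|k]; last by rewrite eqxx.
rewrite dvd1n divn1 => _; exists k => //.
rewrite -kE addrK -[q in LHS](mulfK (_ : (pden s).+1%:R != 0)) ?pnatr_eq0 //.
by congr (_ / _); rewrite [RHS]numqE den1 mulr1.
Qed.

Lemma pzero_rep s : ((pden s).+1 %| E)%N -> pzero s <-> rep s = 0.
Proof.
move=> dvd; split=> [s0|/eqP].
  rewrite /rep (_ : fps_subst _ _ = 0) ?tofrac0 ?mul0r //.
  by apply: fpsP => k /=; rewrite -pcoef_grid s0 if_same.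
rewrite mulf_eq0 (negbTE (laurTXz_neq0 _ _)) orbF tofrac_eq0 => /eqP f0 q.
apply/eqP; apply: contrapT => /negP nz; have [k _ kE] := pcoef_neq0 nz.
case/negP: nz; rewrite kE; have /(congr1 (@fco _ ^~ (k * ram s)%N)) := f0.
by rewrite /= dvdn_mull // mulnK ?ram_gt0 // => ->.
Qed.

Lemma hasval_rep s (k : nat) : ((pden s).+1 %| E)%N ->
  pco s k != 0 -> (forall j, (j < k)%N -> pco s j = 0) ->
  hasval ((ram s)%:Z * (k%:Z - (psh s)%:Z)) (rep s).
Proof.
move=> dvd nzk zj; have r_gt0 := ram_gt0 dvd.
have -> : rep s = (fps_subst (ram s) (Fps (fun j => pco s (k + j))))%:F
    * T ^ ((ram s)%:Z * (k%:Z - (psh s)%:Z)).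
  have -> : (ram s)%:Z * (k%:Z - (psh s)%:Z)
    = (ram s * k)%N%:Z + (- (psh s * ram s)%N%:Z) by lia.
  rewrite laurTD mulrA -[T ^ (Posz _)]tofracXn -tofracM /rep; congr (_%:F * _).
  rewrite -fps_subst_Xn // -fps_substM //; congr fps_subst.
  apply: fpsP => j; rewrite mulrC fco_XnM /=.
  by case: ltnP => [/zj //|le_kj]; rewrite subnKC.
by apply: hasval_unit; rewrite /= dvdn0 div0n addn0.
Qed.

Lemma ram_val s (z : int) : ((pden s).+1 %| E)%N ->
  ((ram s)%:Z * z)%:~R = E%:R * (z%:~R / (pden s).+1%:R) :> rat.
Proof.
move=> dvd; rewrite -{1}(divnK dvd) natrM intrM -/(ram s) pmulrn.
by rewrite -mulrA [_%:R * (_ / _)]mulrC divfK ?pnatr_eq0.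
Qed.

Lemma is_pval_hasval s v : ((pden s).+1 %| E)%N -> is_pval s v ->
  exists2 n : int, n%:~R = E%:R * v & hasval n (rep s).
Proof.
move=> dvd [nzv min_v]; have [k vE kE] := pcoef_neq0 nzv.
exists ((ram s)%:Z * (k%:Z - (psh s)%:Z)); first by rewrite ram_val // vE.
apply: hasval_rep => // [|j lt_jk]; first by rewrite -kE.
rewrite -pcoef_grid; apply: min_v; rewrite vE.
by rewrite ltr_pM2r ?invr_gt0 ?ltr0n // ltr_int ltrD2r.
Qed.

Lemma is_pval_ex s : ((pden s).+1 %| E)%N -> rep s != 0 ->
  exists (w : rat) (n : int),
    [/\ is_pval s w, n%:~R = E%:R * w & hasval n (rep s)].
Proof.
move=> dvd nzs; have ex : exists k, pco s k != 0.
  apply: contrapT => all0; case/negP: nzs; apply/eqP.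
  apply/(pzero_rep dvd) => q; apply/eqP; apply: contrapT => /negP nz.
  by have [k _ kE] := pcoef_neq0 nz; apply: all0; exists k; rewrite -kE.
case: (ex_minnP ex) => k nzk min_k.
have zj j : (j < k)%N -> pco s j = 0.
  by move=> lt_jk; apply/eqP; apply: contraTT lt_jk => /min_k; rewrite -leqNgt.
exists ((k%:Z - (psh s)%:Z)%:~R / (pden s).+1%:R), ((ram s)%:Z * (k%:Z - (psh s)%:Z)).
split; [split|exact: ram_val|exact: hasval_rep].
  by rewrite pcoef_grid.
move=> q lt_q; apply/eqP; apply: contrapT => /negP nz.
have [j qE jE] := pcoef_neq0 nz; case/negP: nz; rewrite jE; apply/eqP/zj.
move: lt_q; rewrite qE ltr_pM2r ?invr_gt0 ?ltr0n // ltr_int ltrD2r.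
by lia.
Qed.
End Representation.

(** * Evaluation on the curve *)

(** In the application [V] is the pole order of [phi], [gam] the valuation of [g_Y(phi)] and [a]
    that of a monomial. With [X = E d^2], the resultant costs [2 C X], its cofactor at most [C X]
    and [gam] at most [C X]; the total [4 C X] fits into the [8 C X] of the conclusion. *)
Lemma val_bound_arith (E d V C : nat) (v gam w a : int) :
  - (V * d)%N%:Z <= gam -> (V <= E * d)%N ->
  C%:Z * (v + gam) - a + w
    <= (E * (2 * (C * d) * d) + (if (0 < C)%N then V * d else 0))%N%:Z ->
  w <= a + (E%:Z * (2 * d * (4 * d + 1))%N%:Z - v) * C%:Z.
Proof.
move=> le_gam le_V le_w; pose X := (E * d * d)%N.
have le_Vd : (V * d <= X)%N by rewrite leq_mul2r le_V orbT.
have le_Cgam : - (C * X)%N%:Z <= C%:Z * gam.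
  have : C%:Z * - X%:Z <= C%:Z * gam by apply: ler_wpM2l => //; lia.
  by lia.
have le_if : ((if (0 < C)%N then V * d else 0) <= C * X)%N.
  by case: C {le_w le_Cgam} => [|C] //=; rewrite mulSn (leq_trans le_Vd) // leq_addr.
have -> : (E%:Z * (2 * d * (4 * d + 1))%N%:Z - v) * C%:Z
    = 8 * (C * X)%N%:Z + 2 * (C * E * d)%N%:Z - C%:Z * v.
  by rewrite /X !PoszM PoszD; ring.
have eX : (E * (2 * (C * d) * d) = 2 * (C * X))%N by rewrite /X; ring.
have {le_w} : C%:Z * v + C%:Z * gam - a + w <= 3 * (C * X)%N%:Z.
  by move: le_w; rewrite mulrDr eX; lia.
by move: (C * X)%N (C * E * d)%N le_Cgam => CX CEd; lia.
Qed.

Lemma hasval_vge (L : fieldType) (n : int) (x : {fraction (fps L)}) :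
  hasval n x -> vge n x.
Proof. by case. Qed.

Lemma vge_hasval (L : fieldType) (n m : int) (x : {fraction (fps L)}) :
  hasval n x -> vge m x -> m <= n.
Proof.
move=> [nzx _ vx'] vx; have := vgeM vx vx'; rewrite mulfV // -tofrac1 => v1.
rewrite leNgt; apply/negP => lt_nm.
have lt0 : 0%N%:Z < m - n by lia.
by have /eqP := vge_fco v1 lt0; rewrite fco1 oner_eq0.
Qed.

Section Evaluation.
Variables (K L : fieldType) (emb : {rmorphism K -> L}) (E : nat).
Hypothesis E_gt0 : (0 < E)%N.
Local Notation F := {fraction (fps L)}.
Local Notation T := (laurT L).
Implicit Types (p c : {poly K}) (A B P g : {poly {poly K}}).

Fact commr_comm (R : nzRingType) (f : R -> F) (u : F) : commr_rmorph f u.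
Proof. by move=> x; apply: mulrC. Qed.

Definition evX : {poly K} -> F := horner_morph (commr_comm (@laurC L \o emb) (T ^+ E)).
HB.instance Definition _ := GRing.RMorphism.copy evX
  (horner_morph (commr_comm (@laurC L \o emb) (T ^+ E))).

Lemma evX_C a : evX a%:P = laurC (emb a). Proof. exact: horner_morphC. Qed.
Lemma evX_X : evX 'X = T ^+ E. Proof. exact: horner_morphX. Qed.

Lemma evX_fps p : evX p = (fps_subst E (Fps (fun k => emb p`_k)))%:F.
Proof.
elim/poly_ind: p => [|p a IHp].
  rewrite rmorph0 (_ : fps_subst _ _ = 0) ?tofrac0 //.
  by apply: fpsP => k /=; rewrite coef0 rmorph0 if_same.
rewrite rmorphD rmorphM /= evX_C evX_X IHp.
have -> : Fps (fun k => emb (p * 'X + a%:P)`_k)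
    = fpsX L ^+ 1 * Fps (fun k => emb p`_k) + fpsC (emb a).
  apply: fpsP => k; rewrite fcoD fco_XnM /= coefD coefMX coefC rmorphD.
  by case: k => [|k] //=; rewrite ?rmorph0 ?add0r ?subn1.
rewrite fps_substD fps_substM // fps_subst_Xn // muln1 tofracD tofracM tofracXn.
rewrite mulrC; congr (_ + _%:F); apply: fpsP => k /=.
have [/dvdnP[q ->]|] := boolP (E %| k)%N.
  by rewrite mulnK // muln_eq0 [E == _]gtn_eqF // orbF.
by case: eqP => // ->; rewrite dvdn0.
Qed.

Lemma vge_evX p : vge 0 (evX p).
Proof. by rewrite evX_fps; apply: vge_tofrac. Qed.

(** The leading coefficient of [p] appears at [t^(E deg p)], so the order cannot exceed that
    exponent. All upper bounds on valuations rest on this. *)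
Lemma vge_evX_le n p : p != 0 -> vge n (evX p) -> n <= (E * (size p).-1)%N%:Z.
Proof.
move=> nzp; rewrite evX_fps leNgt => vp; apply/negP => lt_n.
have /eqP := vge_fco vp lt_n.
by rewrite /= dvdn_mulr // mulKn // fmorph_eq0 -lead_coefE lead_coef_eq0 (negbTE nzp).
Qed.

Variable phi : F.

Definition evXY : {poly {poly K}} -> F := horner_morph (commr_comm evX phi).
HB.instance Definition _ := GRing.RMorphism.copy evXY
  (horner_morph (commr_comm evX phi)).

Lemma evXY_C p : evXY p%:P = evX p. Proof. exact: horner_morphC. Qed.
Lemma evXY_Y : evXY 'X = phi. Proof. exact: horner_morphX. Qed.

Lemma evXY_inj p : evXY p%:P = 0 -> p = 0.
Proof.
rewrite evXY_C => ev0; apply/eqP; apply: contrapT => /negP nzp.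
(* Zero has every valuation bound, in particular one more than the degree allows. *)
have := @vge_evX_le (E * (size p).-1).+1%:Z _ nzp; rewrite ev0.
by move=> /(_ (vge0 _ _)); lia.
Qed.

Lemma evXY_sum A n : (size A <= n)%N ->
  evXY A = \sum_(i < n) evX A`_i * phi ^+ i.
Proof.
move=> sA; rewrite /evXY /horner_morph (@horner_coef_wide _ n).
  by apply: eq_bigr => i _; rewrite coef_map.
exact: leq_trans (size_poly _ _) sA.
Qed.

Lemma vge_evXY (V b : nat) A : vge (- V%:Z) phi -> (size A <= b.+1)%N ->
  vge (- (V * b)%N%:Z) (evXY A).
Proof.
move=> vphi sA; rewrite (evXY_sum sA); apply: vge_sum => i _.
apply: (@vge_le _ (0 + - V%:Z * i%:Z)); last exact: vgeM (vge_evX _) (vge_exp _ _).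
by have := ltn_ord i; nia.
Qed.

(** In [g(phi) = 0] the leading term equals minus the rest, whose pole has order at most [V * m].
    Dividing by [phi ^+ m.+1] leaves a leading coefficient of valuation at least [V], while its
    degree allows at most [E * d]. *)
Lemma root_val_bound (V d : nat) g : bideg_le d g -> (1 < size g)%N ->
  evXY g = 0 -> hasval (- V%:Z) phi -> (V <= E * d)%N.
Proof.
move=> [_ cg] g_gt1 evg hphi; have [nzphi vphi vphi'] := hphi.
have nzg : lead_coef g != 0 by rewrite lead_coef_eq0 -size_poly_gt0 ltnW.
have [m gE] : exists m, size g = m.+2 by case: (size g) g_gt1 => [|[|m]] //; exists m.
move: evg; rewrite (@evXY_sum _ m.+2) ?gE // big_ord_recr /= => /eqP.
rewrite addrC addr_eq0 => /eqP lead_eq.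
have vlead : vge (- (V * m)%N%:Z) (evX g`_m.+1 * phi ^+ m.+1).
  rewrite lead_eq; apply/vgeN/vge_sum => i _.
  apply: (@vge_le _ (0 + - V%:Z * i%:Z)); last exact: vgeM (vge_evX _) (vge_exp _ _).
  by have := ltn_ord i; nia.
have := vgeM vlead (vge_exp m.+1 vphi'); rewrite exprVn mulfK ?expf_neq0 //.
have gm : g`_m.+1 = lead_coef g by rewrite lead_coefE gE.
move=> /vge_evX_le; rewrite gm => /(_ nzg); have := cg m.+1; rewrite gm.
by move: (size _) => s; nia.
Qed.

Hypothesis L0 : [pchar L] =i pred0.

Lemma natE_neq0 : E%:R != 0 :> L.
Proof. by move: L0 => /pcharf0P ->; rewrite -lt0n. Qed.

Local Notation D := (laur_deriv (E%:R : L)).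

Lemma deriv_evX p : D (evX p) = evX ('X * p^`()).
Proof.
apply: (poly_deriv_ext (f := evX) (D1 := D \o evX)
  (D2 := fun p => evX ('X * p^`()))) p => [p q|p q|p q|p q|c|] /=.
- by rewrite rmorphD laur_derivD.
- by rewrite derivD mulrDr rmorphD.
- by rewrite rmorphM laur_derivM.
- by rewrite derivM !(rmorphM, rmorphD) /=; ring.
- by rewrite evX_C laur_derivC derivC mulr0 rmorph0.
- by rewrite derivX mulr1 evX_X laur_deriv_TXn ?natE_neq0.
Qed.

Hypothesis nzphi : phi != 0.

(** The chain rule, with the logarithmic derivative of [phi] because [eulerY] is [Y d/dY]. *)
Lemma deriv_evXY A :
  D (evXY A) = evXY (eulerX A) + evXY (eulerY A) * (D phi / phi).
Proof.
apply: (poly_deriv_ext (f := evXY) (D1 := D \o evXY) (D2 := fun A =>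
  evXY (eulerX A) + evXY (eulerY A) * (D phi / phi))) A => [A B|A B|A B|A B|c|] /=.
- by rewrite rmorphD laur_derivD.
- by rewrite eulerXD eulerYD !rmorphD; ring.
- by rewrite rmorphM laur_derivM.
- by rewrite eulerXM eulerYM !(rmorphD, rmorphM) /=; ring.
- by rewrite eulerXC eulerYC !evXY_C rmorph0 mul0r addr0 deriv_evX.
- by rewrite eulerX_Y eulerY_Y rmorph0 add0r evXY_Y mulrC divfK.
Qed.

Variables (g : {poly {poly K}}) (d : nat).
Hypothesis bg : bideg_le d g.
Hypothesis irr_g : irreducible_elt g.
Hypothesis nzg' : g^`() != 0.
Hypothesis evg : evXY g = 0.

Lemma size_g_gt1 : (1 < size g)%N.
Proof.
rewrite ltnNge; apply: contra nzg' => /size1_polyC ->.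
by rewrite derivC.
Qed.

Definition curve_deriv x := evXY (eulerY g) * D x.

Lemma curve_derivD : {morph curve_deriv : x y / x + y}.
Proof. by move=> x y; rewrite /curve_deriv laur_derivD mulrDr. Qed.

Lemma curve_derivM x y :
  curve_deriv (x * y) = curve_deriv x * y + x * curve_deriv y.
Proof. by rewrite /curve_deriv laur_derivM; ring. Qed.

(** Differentiating [g(X, phi) = 0] gives [X g_X = - Y g_Y * (D phi / phi)]; the factor [Y g_Y] in
    [curve_deriv] thus clears the denominator in the chain rule. *)
Lemma curve_deriv_evXY A : curve_deriv (evXY A) = evXY (tangent g A).
Proof.
have := deriv_evXY g; rewrite evg -(rmorph0 (@laurC L)) laur_derivC => /esym/eqP.
rewrite addr_eq0 => /eqP eX.
rewrite /curve_deriv deriv_evXY /tangent rmorphB /= [evXY (eulerY g * _)]rmorphM.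
by rewrite [evXY (eulerX g * _)]rmorphM /= eX; ring.
Qed.

Lemma iter_curve_deriv i A :
  iter i curve_deriv (evXY A) = evXY (iter i (tangent g) A).
Proof. by elim: i => //= i ->; apply: curve_deriv_evXY. Qed.

Lemma iter_curve_deriv_sum i n (c : 'I_n -> L) (m : 'I_n -> F) :
  iter i curve_deriv (\sum_j laurC (c j) * m j)
  = \sum_j laurC (c j) * iter i curve_deriv (m j).
Proof.
elim: i => //= i ->; rewrite (derivation_sum curve_derivD).
apply: eq_bigr => j _; rewrite curve_derivM /curve_deriv laur_derivC.
by rewrite mulr0 mul0r add0r.
Qed.

Lemma vge_iter_curve_deriv (nu n : int) i x :
  vge nu (evXY (eulerY g)) -> vge n x -> vge (i%:Z * nu + n) (iter i curve_deriv x).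
Proof.
move=> vg vx; elim: i => [|i IHi] /=; first by rewrite mul0r add0r.
have -> : i.+1%:Z * nu + n = nu + (i%:Z * nu + n) by lia.
exact: vgeM vg (vge_deriv _ IHi).
Qed.

Lemma evXY_deriv_neq0 : evXY g^`() != 0.
Proof. exact: (ev_deriv_neq0 irr_g size_g_gt1 evg evXY_inj nzg'). Qed.

Lemma evXY_eulerY : evXY (eulerY g) = phi * evXY g^`().
Proof. by rewrite rmorphM /= evXY_Y. Qed.

Lemma evXY_eulerY_neq0 : evXY (eulerY g) != 0.
Proof. by rewrite evXY_eulerY mulf_neq0 ?evXY_deriv_neq0. Qed.

(** From [R(X) = U(X, phi) P(X, phi)]: the degree bounds the valuation of [R] from above, and [U]
    has a pole of order at most [V * d]. If [P] is constant in [Y], as it must be for [k = 0], its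
    own degree suffices and no pole term arises. *)
Lemma evXY_val_bound (V k : nat) (n : int) P :
  vge (- V%:Z) phi -> bideg_le k P -> evXY P != 0 -> vge n (evXY P) ->
  n <= (E * (2 * k * d) + (if (0 < k)%N then V * d else 0))%N%:Z.
Proof.
move=> vphi bP evP vP; have nzP : P != 0 by apply: contraNneq evP => ->; rewrite rmorph0.
have [P_gt1|] := ltnP 1 (size P); last first.
  move=> /size1_polyC PE; rewrite PE evXY_C in vP; have := bP.2 0%N.
  have nz0 : P`_0 != 0 by apply: contraNneq nzP => P0; rewrite PE P0.
  have d_gt0 : (0 < d)%N by have := bg.1; have := size_g_gt1; lia.
  have := vge_evX_le nz0 vP; move: (size P`_0) => s le_n le_s.
  apply: le_trans le_n _; rewrite lez_nat (leq_trans _ (leq_addr _ _)) //.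
  by rewrite leq_mul2l; apply/orP; right; nia.
have k_gt0 : (0 < k)%N by have := bP.1; lia.
rewrite k_gt0.
have [|R [U [nzR RE sU evR]]] := ev_coprime irr_g size_g_gt1 evg evXY_inj P_gt1 _ nzP.
  by left.
have sU' : (size U <= d.+1)%N by have := bg.1; move: sU; lia.
have := vgeM (vge_evXY vphi sU') vP; rewrite -evR /= evXY_C => /(vge_evX_le nzR).
have := size_resultant_le bP bg; rewrite -RE; move: (size R) => s le_s le_n.
have : (E * s.-1 <= E * (2 * k * d))%N by rewrite leq_mul2l; lia.
by lia.
Qed.

Variables (l : nat) (alpha beta : 'I_l -> nat).
Local Notation m := (fun j => (T ^+ E) ^+ alpha j * phi ^+ beta j).
Hypothesis li : forall lam : 'I_l -> L,
  \sum_j laurC (lam j) * m j = 0 -> forall j, lam j = 0.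

Let P := \det (\matrix_(i < l, j < l) tangent_coef g (alpha j) (beta j) i).
Let W := \det (\matrix_(i < l, j < l) iter i curve_deriv (m j)).

Lemma evXY_monom a b : evXY (monom K a b) = (T ^+ E) ^+ a * phi ^+ b.
Proof. by rewrite rmorphM !rmorphXn /= evXY_Y evXY_C evX_X. Qed.

Lemma wronskian_factor : W = (\prod_j m j) * evXY P.
Proof.
rewrite /P -det_map_mx -det_scale_cols; congr (\det _).
apply/matrixP => i j; rewrite !mxE -evXY_monom iter_curve_deriv.
by rewrite iter_tangent_monom rmorphM.
Qed.

(** Otherwise the [m j] would be dependent over the constants of [curve_deriv]. As [Y g_Y] does not
    vanish on the curve, these constants are those of [D], namely [L], against independence. *)
Lemma wronskian_neq0 : W != 0.
Proof.
apply/eqP => /(wronskian_eq0_dep curve_derivD curve_derivM) [c [j cj] [Dc cm]].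
have /choice [lam lamE] k : exists a, c k = laurC a.
  apply: (laur_deriv_eq0 L0 natE_neq0); apply: (mulfI evXY_eulerY_neq0).
  by rewrite mulr0; apply: Dc.
case/negP: cj; rewrite lamE (li (lam := lam)) ?rmorph0 //.
by rewrite -[RHS]cm; apply: eq_bigr => k _; rewrite lamE.
Qed.

Lemma lacunary_val_bound (v w : int) (c : 'I_l -> L) j0 :
  hasval v phi -> (forall j, c j != 0) ->
  hasval w (\sum_j laurC (c j) * m j) ->
  w <= E%:Z * (alpha j0)%:Z + v * (beta j0)%:Z
       + (E%:Z * (2 * d * (4 * d + 1))%N%:Z - v) * ('C(l, 2))%:Z.
Proof.
move=> hv nzc hw; set psi := \sum_j _ in hw.
pose a j := E%:Z * (alpha j)%:Z + v * (beta j)%:Z.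
have hm j : hasval (a j) (m j).
  by apply: hasvalM; apply: hasvalX => //; rewrite -[T ^+ E]/(T ^ E%:Z); apply: hasval_laurT.
have [gam hgam] := hasval_ex evXY_deriv_neq0.
(* The pole order of [phi], equal to 0 when [v] is nonnegative. *)
pose V := `|Num.min v 0|%N.
have vphi : vge (- V%:Z) phi by apply: vge_le (hasval_vge hv); rewrite /V; lia.
have le_gam : - (V * d)%N%:Z <= gam.
  apply: (vge_hasval hgam); apply: vge_evXY => //.
  by apply: leq_trans (leq_trans (size_poly _ _) (leq_pred _)) bg.1.
have le_V : (V <= E * d)%N.
  have [v_ge0|v_lt0] := leP 0 v; first by rewrite /V; lia.
  by apply: (root_val_bound bg size_g_gt1 evg); rewrite (_ : - V%:Z = v) // /V; lia.
have hY : hasval (v + gam) (evXY (eulerY g)) by rewrite evXY_eulerY; apply: hasvalM.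
(* By Cramer's rule column [j0] may hold the derivatives of [psi]. Row [i] then weighs
   [i * (v + gam)], column [j0] weighs [w], and every other column [a j]. *)
have vdet : vge ('C(l, 2)%:Z * (v + gam) + (\sum_j a j - a j0 + w)) (laurC (c j0) * W).
  rewrite /W -(det_replace_col _ (fun j => laurC (c j))).
  have -> : 'C(l, 2)%:Z * (v + gam) = \sum_(i < l) i%:Z * (v + gam).
    rewrite -mulr_suml -bin2_sum big_mkord; congr (_ * _).
    by rewrite (big_morph Posz PoszD (erefl _)).
  have -> : \sum_j a j - a j0 + w = \sum_j (if j == j0 then w else a j).
    rewrite (bigD1 j0) //= [RHS](bigD1 j0) //= eqxx [a j0 + _]addrC addrK addrC.
    by congr (_ + _); apply: eq_bigr => j /negbTE ->.
  apply: (filtered_det (@vge0 L) _ (@vgeD L) (@vgeN L) (@vgeM L)) => [|i j].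
    by rewrite -tofrac1; apply: vge_tofrac.
  rewrite mxE; case: eqP => [_|_].
    under eq_bigr do rewrite mxE.
    rewrite -iter_curve_deriv_sum; apply: vge_iter_curve_deriv; first exact: hasval_vge hY.
    exact: hasval_vge hw.
  by rewrite mxE; apply: vge_iter_curve_deriv; [exact: hasval_vge hY|exact: hasval_vge (hm _)].
have hc : hasval 0 (laurC (c j0)).
  by have := @hasval_unit _ (fpsC (c j0)) 0; rewrite mulr1 /=; apply.
have evP : evXY P != 0.
  by have := wronskian_neq0; rewrite wronskian_factor mulf_eq0 negb_or => /andP[].
have hmW := hasvalM hc (hasval_prod hm).
(* Dividing by [c j0] and by the product of the monomials cancels the sum of the [a j]. *)
have vP : vge ('C(l, 2)%:Z * (v + gam) - a j0 + w) (evXY P).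
  have [nz _ vinv] := hmW; have := vgeM vinv vdet.
  rewrite wronskian_factor [laurC _ * (_ * _)]mulrA mulKf //; apply: vge_le.
  by move: (\sum_j a j) (_ * (v + gam)) (a j0) => S Cvg aj; lia.
have bP := bideg_le_wronskian_coef alpha beta bg.
have := evXY_val_bound vphi bP evP vP.
have d_gt0 : (0 < d)%N by have := bg.1; have := size_g_gt1; lia.
(* Since [d > 0], the bidegree ['C(l, 2) * d] is positive exactly when ['C(l, 2)] is. *)
by rewrite muln_gt0 d_gt0 andbT -/(a j0) => /(val_bound_arith le_gam le_V).
Qed.
End Evaluation.

(** * Puiseux expressions in [phi] as evaluations of polynomials *)

Section RepresentationOfEvaluation.
Variables (K L : fieldType) (emb : {rmorphism K -> L}) (E : nat).
Hypothesis E_gt0 : (0 < E)%N.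
Variable phi : puis L.

Lemma rep_poly p : rep E (ppoly emb p) = evX emb E p.
Proof.
by rewrite evX_fps // /rep /ram /= divn1 mul0n oppr0 expr0z mulr1.
Qed.

Lemma dvdn_pden_psum (I : eqType) (r : seq I) (s : I -> puis L) i :
  ((pden (psum [seq s j | j <- r])).+1 %| E)%N -> i \in r ->
  ((pden (s i)).+1 %| E)%N.
Proof.
move=> dvd r_i; apply: dvdn_trans dvd; rewrite pden_psum big_map.
by rewrite (big_rem i) //= dvdn_mulr.
Qed.

Lemma rep_eval g : ((pden (peval emb g phi)).+1 %| E)%N ->
  rep E (peval emb g phi) = evXY emb E (rep E phi) g.
Proof.
move=> dvd; rewrite /peval rep_sum // big_map (evXY_sum emb E _ (leqnn _)).
rewrite -(big_mkord predT (fun i => evX emb E g`_i * rep E phi ^+ i)) /index_iota subn0.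
apply: eq_big_seq => i r_i.
have dvd_i := dvdn_pden_psum dvd r_i; rewrite pden_pmul mul1n in dvd_i.
by rewrite rep_mul ?mul1n // rep_poly rep_pow // -pden_ppow.
Qed.

Variables (l : nat) (alpha beta : 'I_l -> nat).

Lemma pden_pscale a s : pden (@pscale L a s) = pden s.
Proof. by []. Qed.

Lemma pden_lacunary (lam : 'I_l -> L) :
  (pden (psum [seq pscale (lam j) (pmul (pX L (alpha j)) (ppow phi (beta j)))
              | j <- enum 'I_l])).+1
  = (\prod_(j <- enum 'I_l) (pden phi).+1 ^ beta j)%N.
Proof.
rewrite pden_psum big_map; apply: eq_bigr => j _.
by rewrite pden_pscale pden_pmul mul1n pden_ppow.
Qed.

Lemma rep_lacunary (lam : 'I_l -> L) :
  (\prod_(j <- enum 'I_l) (pden phi).+1 ^ beta j %| E)%N ->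
  rep E (psum [seq pscale (lam j) (pmul (pX L (alpha j)) (ppow phi (beta j)))
            | j <- enum 'I_l])
  = \sum_j laurC (lam j) * ((laurT L ^+ E) ^+ alpha j * rep E phi ^+ beta j).
Proof.
rewrite -(pden_lacunary lam) => dvd; rewrite rep_sum // big_map big_enum /=.
apply: eq_bigr => j _.
have := dvdn_pden_psum dvd (mem_enum _ j); rewrite pden_pscale pden_pmul mul1n => dvd_j.
by rewrite rep_scale rep_mul ?mul1n // rep_X // rep_pow // -pden_ppow.
Qed.
End RepresentationOfEvaluation.

(** * Passage from [t]-valuations back to rational valuations in [X] *)

Theorem theorem4 (K : fieldType) (L : closedFieldType) (emb : {rmorphism K -> L})
  (HK : [pchar K] =i pred0)
  (Halg : forall x : L, exists2 p : {poly K}, p != 0 & root (map_poly emb p) x)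
  (g : {poly {poly K}}) (d : nat)
  (Hirr : irreducible_elt g) (Hd : tdeg g = d) (Hder : g^`() != 0)
  (phi : puis L) (v : rat)
  (Hroot : pzero (peval emb g phi)) (Hv : is_pval phi v)
  (l : nat) (c : 'I_l.+1 -> L) (alpha beta : 'I_l.+1 -> nat)
  (Hc : forall j, c j != 0)
  (Hdist : injective (fun j => (alpha j, beta j)))
  (Hli : forall lam : 'I_l.+1 -> L,
      pzero (psum [seq pscale (lam j) (pmul (pX L (alpha j)) (ppow phi (beta j)))
                  | j <- enum 'I_l.+1]) ->
      forall j, lam j = 0) :
  exists w : rat,
    is_pval (psum [seq pscale (c j) (pmul (pX L (alpha j)) (ppow phi (beta j)))
                  | j <- enum 'I_l.+1]) w /\
    w <= \big[Num.min/((alpha ord0)%:R + v * (beta ord0)%:R)]_(j < l.+1)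
            ((alpha j)%:R + v * (beta j)%:R)
         + ((2 * d * (4 * d + 1))%N%:R - v) * ('C(l.+1, 2))%:R.
Proof.
pose B := (\prod_(j <- enum 'I_l.+1) (pden phi).+1 ^ beta j)%N.
(* A common multiple of the denominators of [phi], of [g(X, phi)] and of all the linear
   combinations; [B] serves every choice of coefficients, as scaling keeps denominators. *)
pose E := ((pden phi).+1 * (pden (peval emb g phi)).+1 * B)%N.
have E_gt0 : (0 < E)%N.
  by rewrite !muln_gt0 /=; apply: prodn_gt0 => j; rewrite expn_gt0.
have dvd_phi : ((pden phi).+1 %| E)%N by rewrite /E -mulnA dvdn_mulr.
have dvd_g : ((pden (peval emb g phi)).+1 %| E)%N by rewrite /E mulnAC dvdn_mull.
have dvd_B : (B %| E)%N by rewrite /E dvdn_mull.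
have L0 : [pchar L] =i pred0 by move=> p; rewrite (fmorph_pchar emb) HK.
have [n nE hn] := is_pval_hasval E_gt0 dvd_phi Hv.
have [nzphi _ _] := hn.
have evg : evXY emb E (rep E phi) g = 0.
  by rewrite -rep_eval //; apply/(pzero_rep E_gt0 dvd_g).
have bg : bideg_le d g by rewrite -Hd; apply: bideg_le_tdeg.
have li (lam : 'I_l.+1 -> L) :
    \sum_j laurC (lam j) * ((laurT L ^+ E) ^+ alpha j * rep E phi ^+ beta j) = 0 ->
    forall j, lam j = 0.
  rewrite -rep_lacunary // => lam0; apply: Hli.
  by apply/(pzero_rep E_gt0); rewrite ?pden_lacunary.
have nz_psi : rep E (psum [seq pscale (c j) (pmul (pX L (alpha j)) (ppow phi (beta j)))
    | j <- enum 'I_l.+1]) != 0.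
  apply/eqP; rewrite rep_lacunary // => /li/(_ ord0)/eqP.
  by rewrite (negbTE (Hc _)).
have [|w [m [pw mE hm]]] := is_pval_ex E_gt0 _ nz_psi; first by rewrite pden_lacunary.
exists w; split=> //; rewrite rep_lacunary // in hm.
have le_w j : w <= (alpha j)%:R + v * (beta j)%:R
    + ((2 * d * (4 * d + 1))%N%:R - v) * ('C(l.+1, 2))%:R.
  have := lacunary_val_bound E_gt0 L0 nzphi bg Hirr Hder evg li j hn Hc hm.
  (* The integer inequality is the rational one multiplied by [E]. *)
  rewrite -(ler_int rat) mE !(intrD, intrM, mulrNz) nE -!pmulrn.
  rewrite -[X in _ <= X](_ : E%:R * ((alpha j)%:R + v * (beta j)%:R
    + ((2 * d * (4 * d + 1))%N%:R - v) * ('C(l.+1, 2))%:R) = _); last by ring.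
  by rewrite ler_pM2l // ltr0n.
(* The bound holds for each [j] separately, hence for the minimum; its default value is the term at
   [ord0], covered as well. *)
rewrite -lerBlDr; elim/big_ind: _ => [|x y lex ley|j _].
- by rewrite lerBlDr.
- by rewrite le_min lex.
- by rewrite lerBlDr.
Qed.
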